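(* Let $\mathcal{D}$ be a distribution over samples $(\bm{x},y)$ and $\ell(\bm{w},\bm{x},y)$ a loss differentiable in $\bm{w}\in\mathbb{R}^d$. Suppose there is a function $G(\bm{x},y)\ge0$ with $\|\nabla_{\bm{w}}\ell(\bm{w},\bm{x},y)\|\le G(\bm{x},y)$ for all $\bm{w}\in\mathbb{R}^d$ and all $(\bm{x},y)$ in the support of $\mathcal{D}$, and that for some $k>1$ and $G>0$, $\left(\mathbb{E}_{(\bm{x},y)\sim\mathcal{D}}[G(\bm{x},y)^k]\right)^{1/k}\le G$. Let $\mathcal{Z}=\{(\bm{x}_i,y_i)\}_{i=1}^n$ be i.i.d. from $\mathcal{D}$, $f_i(\bm{w})=\ell(\bm{w},\bm{x}_i,y_i)$, $f=\frac1n\sum_if_i$, and take $\mathcal{W}=\mathbb{R}^d$. Suppose (for the dataset obtained) $f$ is convex with a minimizer $\bm{w}^*\in\arg\min_{\bm{w}\in\mathbb{R}^d}f(\bm{w})$, and there is a constant $D>0$ such that for every $\bm{w}$ with $\|\bm{w}-\bm{w}^*\|>D$, $$f(\bm{w})-f(\bm{w}^* )>16\,\varphi^{1-\frac1k}G\,\|\bm{w}-\bm{w}^*\|.$$ Fix $C>0$, take $T\ge\frac1{\varphi^2}$, and run DP-SGD with $\tau=G\left(\frac1T+\varphi^2\right)^{-\frac1{2k}}$, $\eta_t=\eta=\frac{C}{T\tau}\left(\frac1T+\varphi^2\right)^{-\frac12}$ for all $t<T$, and $\sigma_n^2=\frac{\nu T\log(1/\delta)\tau^2}{n^2\varepsilon^2}$.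 Then with probability at least $3/4$ over the random dataset $\mathcal{Z}$, $$\mathrm{OR}(T)\le G\left\{\left(\frac{\|\bm{w}_0-\bm{w}^*\|^2}{C}+2C\right)\left(\frac1T+\varphi^2\right)^{\frac12(1-\frac1k)}+16\varphi^{1-\frac1k}D\right\}.$$ In particular, for $T=\frac1{\varphi^2}$, $\mathrm{OR}(T)\le G\left\{2^{\frac12(1-\frac1k)}\left(\frac{\|\bm{w}_0-\bm{w}^*\|^2}{C}+2C\right)+16D\right\}\varphi^{1-\frac1k}$.
   Context: For $\bm{z}\in\mathbb{R}^d$ and $c>0$, $\mathrm{clip}(\bm{z},c)=\bm{z}\min(1,c/\|\bm{z}\|)$ ($\|\cdot\|$ Euclidean). DP-SGD (unconstrained): given $\bm{w}_0\in\mathbb{R}^d$, $T$, step sizes $\eta_t$, a parameter $b\ge1$, clip norm $\tau$, noise variance $\sigma_n^2$: for $t=0,\dots,T-1$, form $\mathcal{S}_t\subseteq[n]$ by including each index independently with probability $b/n$; $\bm{g}_t=\frac1b\sum_{i\in\mathcal{S}_t}\mathrm{clip}(\nabla f_i(\bm{w}_t),\tau)+\bm{\zeta}_t$, $\bm{\zeta}_t\sim\mathcal{N}(\bm{0},\sigma_n^2I_d)$ independent; $\bm{w}_{t+1}=\bm{w}_t-\eta_t\bm{g}_t$. Output $\bm{w}_{\mathrm{priv}}=\bm{w}_{\widehat t}$, $\widehat t$ uniform on $\{0,\dots,T-1\}$. Here $\varepsilon>0$, $\delta\in(0,1)$, $\nu>0$ a fixed absolute constant, $\varphi=\frac{\sqrt{\nu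 d\log(1/\delta)}}{n\varepsilon}$. The optimization risk is $\mathrm{OR}(T)=\mathbb{E}[f(\bm{w}_{\mathrm{priv}})]-f(\bm{w}^* )$, the expectation over the algorithm's randomness conditional on $\mathcal{Z}$. *)

(* Defs.v *)
From HB Require Import structures.
From mathcomp Require Import all_boot all_order all_algebra.
From mathcomp Require Import all_classical all_reals all_analysis.
Set Implicit Arguments. Unset Strict Implicit. Unset Printing Implicit Defensive.
Import Order.TTheory GRing.Theory Num.Theory.
Local Open Scope classical_set_scope.
Local Open Scope ring_scope.

Section Defs.
Context {R : realType}.

Definition enorm {d : nat} (v : 'rV[R]_d) : R :=
  Num.sqrt (\sum_(j < d) v 0 j ^+ 2).

(* clip(z, c) = z * min(1, c / ||z||)   (for z = 0 this is 0 = z) *)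
Definition clip {d : nat} (z : 'rV[R]_d) (c : R) : 'rV[R]_d :=
  Num.min 1 (c / enorm z) *: z.

Definition grad {d : nat} (F : 'rV[R]_d -> R) w : 'rV[R]_d :=
  let L := 'd F w in \row_(j < d) (L (delta_mx 0 j)).

Definition convex_fun {d : nat} (f : 'rV[R]_d -> R) : Prop :=
  forall (u v : 'rV[R]_d) (a : R), 0 <= a -> a <= 1 ->
    f (a *: u + (1 - a) *: v) <= a * f u + (1 - a) * f v.

Definition preimage_sets {dT dU} {T : measurableType dT} {U : measurableType dU}
  (X : T -> U) : set (set T) := [set X @^-1` B | B in measurable].

Definition mutually_independent {dT} {T : measurableType dT} {I : eqType}
  (P : probability T R) (F : I -> set (set T)) : Prop :=
  forall (J : seq I) (A : I -> set T), uniq J ->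
    (forall j, j \in J -> F j (A j)) ->
    P (\bigcap_(j in [set j | j \in J]) A j) = (\prod_(j <- J) P (A j))%E.

(* the family of sigma-algebras of all random elements used by DP-SGD:
   Poisson-subsampling masks M t i, Gaussian noise coordinates Zeta t j,
   and the output index That *)
Definition alg_family {dO} {Om : measurableType dO} {n d : nat}
  (M : nat -> 'I_n -> Om -> bool) (Zeta : nat -> 'I_d -> Om -> R)
  (That : Om -> nat) : ((nat * 'I_n) + (nat * 'I_d) + unit)%type -> set (set Om) :=
  fun i => match i with
           | inl (inl p) => preimage_sets (M p.1 p.2)
           | inl (inr p) => preimage_sets (Zeta p.1 p.2)
           | inr _ => preimage_sets That
           end.

Fixpoint dpsgd {dO} {Om : measurableType dO} {n d : nat}
  (fi : 'I_n -> 'rV[R]_d -> R) (b eta tau : R)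
  (M : nat -> 'I_n -> Om -> bool) (Zeta : nat -> 'I_d -> Om -> R)
  (w0 : 'rV[R]_d) (t : nat) (om : Om) : 'rV[R]_d :=
  match t with
  | 0 => w0
  | t'.+1 =>
      let w := dpsgd fi b eta tau M Zeta w0 t' om in
      w - eta *: (b^-1 *: (\sum_(i < n | M t' i om) clip (grad (fi i) w) tau)
                  + \row_(j < d) Zeta t' j om)
  end.

Definition dp_phi (nu : R) (d n : nat) (eps delta : R) : R :=
  Num.sqrt (nu * d%:R * ln (delta^-1)) / (n%:R * eps).

End Defs.

(* Main.v *)
Require Import Defs.
From HB Require Import structures.
From mathcomp Require Import all_boot all_order all_algebra.
From mathcomp Require Import all_classical all_reals all_analysis.
From mathcomp Require Import measurable_realfun ring lra.
Import Order.TTheory GRing.Theory Num.Theory.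
Import numFieldNormedType.Exports.
Local Open Scope classical_set_scope.
Local Open Scope ring_scope.

(** Markov's inequality applied to the empirical [k]-th moment of the gradient
    envelope gives, with probability at least 3/4, [n^-1 * sum_i G_i^k <= 4 G^k].
    On this event clipping at [tau] biases the mean gradient by at most
    [4 G^k tau^(1-k) <= 8 phi^(1-1/k) G].  Inside the ball of radius [D] this bias
    costs at most [bias * D]; outside it the growth condition absorbs the bias into
    half of the suboptimality gap.  Hence
    [f w - f w* <= 2 <mean clipped gradient, w - w*> + 16 phi^(1-1/k) G D]
    everywhere, and the usual telescoping of [E |w_t - w*|^2] bounds the average of
    the inner products.  The second moment of a noisy step is at most
    [2 tau^2 + d sigma_n^2 <= 2 tau^2 T (1/T + phi^2)]. *)

(** * Independence of generated sigma-algebras *)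

(** The growth slope 16 is exactly twice the bias constant 8. Markov contributes a factor 4;
    [T >= phi^-2] bounds [1/T + phi^2] by [2 phi^2], and raising to the power [(1-1/k)/2] costs a
    factor of at most 2. The obstacle is probabilistic. Independence is assumed for events only,
    whereas each step must factor the expectation of a function of the past times a fresh mask or a
    fresh noise coordinate. So every iterate is shown measurable for the sigma-algebra generated by
    the earlier indices, and independence is carried from events to sigma-algebras and then to
    products of integrable variables. Integrability also needs an argument, since the noise makes
    the iterates unbounded. The induction over steps carries the finiteness of [E |w_t - wstar|^2],
    and [f (w_t)] is integrable because its gap lies between 0 and the integrable right-hand side of
    the descent inequality. *)

Definition cylinders {T : Type} {I : eqType} (F : I -> set (set T)) (L : set I)
    : set (set T) :=
  [set B | exists (J : seq I) (A : I -> set T),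
    [/\ uniq J, (forall j, j \in J -> L j /\ F j (A j))
      & B = \bigcap_(j in [set j | j \in J]) A j]].

(** Makes the cylinders a pi-system generating the joint sigma-algebra of the indices in [L]. Two
    cylinders are merged over the union of their index lists, an index missing from one list being
    padded by [setT]. *)
Lemma cylinders_setI_closed (T : Type) (I : eqType) (F : I -> set (set T))
    (L : set I) :
  (forall i, F i setT) -> (forall i, setI_closed (F i)) ->
  setI_closed (cylinders F L).
Proof.
move=> FT FI _ _ [J1 [A1 [uJ1 LA1 ->]]] [J2 [A2 [uJ2 LA2 ->]]].
pose A j := (if j \in J1 then A1 j else setT) `&`
            (if j \in J2 then A2 j else setT).
exists (undup (J1 ++ J2)), A; split; first exact: undup_uniq.
- move=> j; rewrite mem_undup mem_cat => jJ; split.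
    by case/orP: jJ => [/LA1|/LA2] [].
  by apply: FI; case: ifPn => // jJ'; [case: (LA1 _ jJ')|case: (LA2 _ jJ')].
- apply/seteqP; split => x.
    move=> [h1 h2] j /= _; split.
      by case: ifPn => // /h1.
    by case: ifPn => // /h2.
  move=> h; split => j /= jJ.
    have := h j; rewrite /= mem_undup mem_cat jJ => /(_ isT) [].
    by rewrite jJ.
  have := h j; rewrite /= mem_undup mem_cat jJ orbT => /(_ isT) [_].
  by rewrite jJ.
Qed.

Lemma sub_cylinders (T : Type) (I : eqType) (F : I -> set (set T))
    (L : set I) (i : I) : L i -> F i `<=` cylinders F L.
Proof.
move=> Li A FA; exists [:: i], (fun=> A); split => //.
- by move=> j; rewrite inE => /eqP ->.
- apply/seteqP; split => [x Ax j _ //|x]; apply; by rewrite /= inE.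
Qed.

Lemma cylinders_measurable (d : measure_display) (T : measurableType d)
    (I : eqType) (F : I -> set (set T)) (L : set I) :
  (forall i, F i `<=` measurable) -> cylinders F L `<=` measurable.
Proof.
move=> mF _ [J [A [uJ LA ->]]].
by apply: fin_bigcap_measurable => // j /= /LA [_ /mF].
Qed.

(** The events that factor with a fixed [B] form a lambda-system, so the pi-lambda theorem extends
    the property from [G] to the sigma-algebra it generates. *)
Lemma indep_dynkin (R : realType) (d : measure_display) (T : measurableType d)
    (P : probability T R) (G : set (set T)) (B : set T) :
  setI_closed G -> G `<=` measurable -> measurable B ->
  (forall A, G A -> P (A `&` B) = P A * P B)%E ->
  forall A, <<s G >> A -> (measurable A /\ P (A `&` B) = P A * P B)%E.
Proof.
move=> GI Gm mB GB.
have fPm A : measurable A -> P A \is a fin_num by move=> mA; rewrite fin_num_measure.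
pose H := [set A | measurable A /\ (P (A `&` B) = P A * P B)%E].
suff : <<s G >> `<=` H by move=> + A GA; apply.
apply: lambda_system_subset => //.
- apply/dynkin_lambda_system; split.
  + by split => //; rewrite setTI probability_setT mul1e.
  + move=> A [mA AB]; split; first exact: measurableC.
    have -> : ~` A `&` B = B `\` (A `&` B).
      apply/seteqP; split => x /=; first by move=> [nA xB]; split => // -[].
      by move=> [xB nAB]; split => // xA; apply: nAB.
    rewrite measureD//; last 2 first.
      exact: measurableI.
      by rewrite ltey_eq fPm.
    rewrite setICA setIid probability_setC// [X in (_ - X)%E]AB.
    by rewrite muleBl ?fPm// ?mul1e// fin_num_adde_defr.
  + move=> A tA HA; have mA n : measurable (A n) by case: (HA n).
    split; first exact: bigcupT_measurable.
    have mAB n : measurable (A n `&` B) by exact: measurableI.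
    rewrite setI_bigcupl.
    have h1 := @measure_sigma_additive _ _ _ P _ mAB (trivIset_setIr tA).
    have h2 := @measure_sigma_additive _ _ _ P _ mA tA.
    have h3 : \sum_(0 <= i < n) P (A i) @[n --> \oo] --> P (\bigcup_n A n) := h2.
    have h4 : ((\sum_(0 <= i < n) P (A i)) * P B)%E @[n --> \oo] -->
              (P (\bigcup_n A n) * P B)%E.
      by apply: cvgeZr => //; exact: fPm.
    apply: cvg_unique h4 => //=.
    suff -> : (fun n => (\sum_(0 <= i < n) P (A i)) * P B)%E =
              (fun n => \sum_(0 <= i < n) P (A i `&` B))%E by [].
    apply/funext => n; rewrite ge0_sume_distrl//.
    by apply: eq_bigr => i _; case: (HA i).
- by move=> A GA; split; [exact: Gm|exact: GB].
Qed.

(** Mutual independence settles two cylinders: as [L1] and [L2] are disjoint, their index lists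
    concatenate into one duplicate-free list. [indep_dynkin] then frees one argument at a time. *)
Lemma indep_sigma (R : realType) (d : measure_display) (T : measurableType d)
    (P : probability T R) (I : eqType) (F : I -> set (set T)) (L1 L2 : set I) :
  (forall i, F i `<=` measurable) -> (forall i, F i setT) ->
  (forall i, setI_closed (F i)) ->
  mutually_independent P F -> L1 `&` L2 = set0 ->
  forall A B, <<s cylinders F L1 >> A -> <<s cylinders F L2 >> B ->
  (P (A `&` B) = P A * P B)%E.
Proof.
move=> mF FT FI iF L12 A B sA sB.
have cc A1 A2 : cylinders F L1 A1 -> cylinders F L2 A2 ->
    (P (A1 `&` A2) = P A1 * P A2)%E.
  move=> [J1 [B1 [uJ1 LB1 ->]]] [J2 [B2 [uJ2 LB2 ->]]].
  have J12 j : j \in J1 -> j \in J2 -> False.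
    move=> /LB1 [L1j _] /LB2 [L2j _].
    by have : (L1 `&` L2) j by []; rewrite L12.
  pose C j := if j \in J1 then B1 j else B2 j.
  have uJ : uniq (J1 ++ J2).
    rewrite cat_uniq uJ1 uJ2 andbT /=; apply/hasPn => j /= j2; apply/negP => j1.
    exact: (J12 j).
  have C1 j : j \in J1 -> C j = B1 j by rewrite /C => ->.
  have C2 j : j \in J2 -> C j = B2 j.
    by rewrite /C; case: ifPn => // j1 j2; case: (J12 j).
  have FC j : j \in J1 ++ J2 -> F j (C j).
    rewrite mem_cat => /orP[jJ|jJ]; first by rewrite C1//; case: (LB1 _ jJ).
    by rewrite C2//; case: (LB2 _ jJ).
  have e1 : P (\bigcap_(j in [set j | j \in J1]) B1 j) =
           (\prod_(j <- J1) P (C j))%E.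
    rewrite -iF//; last by move=> j jJ; apply: FC; rewrite mem_cat jJ.
    by congr (P _); apply: eq_bigcapr => j /= jJ; rewrite C1.
  have e2 : P (\bigcap_(j in [set j | j \in J2]) B2 j) =
           (\prod_(j <- J2) P (C j))%E.
    rewrite -iF//; last by move=> j jJ; apply: FC; rewrite mem_cat jJ orbT.
    by congr (P _); apply: eq_bigcapr => j /= jJ; rewrite C2.
  rewrite e1 e2 -big_cat/= -iF//; congr (P _).
  apply/seteqP; split => x.
    by move=> [h1 h2] j /=; rewrite mem_cat => /orP[jJ|jJ];
      [rewrite C1//; exact: h1|rewrite C2//; exact: h2].
  by move=> h; split => j /= jJ; [rewrite -C1//|rewrite -C2//];
    apply: h; rewrite /= mem_cat jJ ?orbT.
have cI L := cylinders_setI_closed T I F L FT FI.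
have cm L := cylinders_measurable d T I F L mF.
have mB : measurable B.
  by move: B sB; apply: smallest_sub; [exact: sigma_algebra_measurable|exact: cm].
apply: (indep_dynkin R d T P (cylinders F L1) B _ _ _ _ A sA).2 => //.
move=> A1 cA1; rewrite setIC muleC.
  apply: (indep_dynkin R d T P (cylinders F L2) A1 _ _ _ _ B sB).2 => //.
    exact: (cm L1).
  by move=> A2 cA2; rewrite setIC muleC; exact: cc.
Qed.

Definition indep2 {R : realType} {d} {T : measurableType d}
    (P : probability T R) (Y Z : T -> R) : Prop :=
  forall A B, measurable A -> measurable B ->
  (P (Y @^-1` A `&` Z @^-1` B) = P (Y @^-1` A) * P (Z @^-1` B))%E.

(** By independence the law of the pair [(Y, Z)] agrees with the product of the marginal laws on
    rectangles, hence everywhere; Fubini for [y * z] under the product law factors the integral. *)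
Lemma indep2_integralM (R : realType) (d : measure_display)
    (T : measurableType d) (P : probability T R) (Y Z : T -> R) :
  measurable_fun setT Y -> measurable_fun setT Z -> indep2 P Y Z ->
  P.-integrable setT (EFin \o Y) -> P.-integrable setT (EFin \o Z) ->
  P.-integrable setT (EFin \o (Y \* Z)) /\
  \int[P]_x (Y x * Z x) = \int[P]_x Y x * \int[P]_x Z x.
Proof.
move=> mY mZ iYZ intY intZ.
pose Y' : {mfun T >-> R} := HB.pack Y (isMeasurableFun.Build _ _ _ _ _ mY).
pose Z' : {mfun T >-> R} := HB.pack Z (isMeasurableFun.Build _ _ _ _ _ mZ).
have mYZ : measurable_fun setT (fun x => (Y x, Z x)).
  by apply/measurable_fun_pairP.
pose W : {mfun T >-> (R * R)%type} :=
  HB.pack (fun x => (Y x, Z x)) (isMeasurableFun.Build _ _ _ _ _ mYZ).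
pose m1 := distribution P Y'; pose m2 := distribution P Z'.
pose m := distribution P W.
have mE X : measurable X -> (m1 \x m2)%E X = m X.
  apply: product_measure_unique => A B mA mB.
  by rewrite /m /m1 /m2 /distribution /pushforward -iYZ.
pose f (z : R * R) : \bar R := (z.1 * z.2)%:E.
have mf : measurable_fun [set: R * R] f.
  by apply/measurable_EFinP; apply: measurable_funM.
have mabs : measurable_fun [set: R] (fun y : R => `|y%:E|%E).
  by apply: measurableT_comp => //; exact: EFin_measurable.
have eY : (\int[m1]_y `|y%:E| = \int[P]_x `|(Y x)%:E|)%E.
  by rewrite ge0_integral_pushforward.
have eZ : (\int[m2]_y `|y%:E| = \int[P]_x `|(Z x)%:E|)%E.
  by rewrite ge0_integral_pushforward.
(* Tonelli for [|y z|] comes first: it supplies the integrability that Fubini needs. *)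
have intf : (m1 \x m2)%E.-integrable setT f.
  apply/integrable12ltyP => //.
  have eK x : (\int[m2]_y `|f (x, y)| = `|x%:E| * \int[P]_x `|(Z x)%:E|)%E.
    rewrite -eZ -ge0_integralZl//.
    by apply: eq_integral => y _; rewrite /f /= normrM EFinM.
  under eq_integral do rewrite eK.
  rewrite ge0_integralZr//.
  + rewrite -[X in (X * _)%E]/(\int[m1]_y `|y%:E|)%E eY.
    move/integrableP: intY => [_ Yoo]; move/integrableP: intZ => [_ Zoo].
    by apply: lte_mul_pinfty => //; [exact: integral_ge0|
      rewrite ge0_fin_numE//; exact: integral_ge0].
  + exact: integral_ge0.
have intm : m.-integrable setT f.
  apply/integrableP; split => //; move/integrableP: intf => [_].
  by rewrite (eq_measure_integral m)// => A mA _; exact: mE.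
have intYZ : P.-integrable setT (EFin \o (Y \* Z)).
  apply/integrableP; split.
    by apply/measurable_EFinP; apply: measurable_funM.
  move/integrableP : intm => [_]; rewrite ge0_integral_pushforward//.
  exact: measurableT_comp.
have cY : (\int[m1]_y y%:E = \int[P]_x (Y x)%:E)%E.
  by rewrite integral_pushforward.
have cZ : (\int[m2]_y y%:E = \int[P]_x (Z x)%:E)%E.
  by rewrite integral_pushforward.
split => //.
rewrite /Rintegral -[X in fine X](_ : (\int[m]_z f z)%E = _); last first.
  by rewrite integral_pushforward.
rewrite (eq_measure_integral (m1 \x m2)%E); last first.
  by move=> A mA _; exact: esym (mE A mA).
rewrite -integral12_prod_meas1//.
rewrite -fineM; [|exact: integrable_fin_num|exact: integrable_fin_num].
congr fine; rewrite -cY -cZ /fubini_F.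
have im2 : m2.-integrable setT (EFin \o id).
  apply/integrableP; split; first exact: EFin_measurable.
  by rewrite /= eZ; move/integrableP: intZ => [].
have im1 : m1.-integrable setT (EFin \o id).
  apply/integrableP; split; first exact: EFin_measurable.
  by rewrite /= eY; move/integrableP: intY => [].
have eK x : (\int[m2]_y f (x, y) = x%:E * \int[m2]_y y%:E)%E.
  by rewrite -integralZl//; apply: eq_integral => y _; rewrite /f /= EFinM.
under eq_integral do rewrite eK.
have /fineK <- : (\int[m2]_y y%:E)%E \is a fin_num.
  exact: integrable_fin_num im2.
exact: integralZr.
Qed.

(** * Measurability of functions of random vectors *)

(** Serves twice: with [g] a rounding to a countable grid, and with [g] the random output index. *)
Lemma measurable_fun_countable (d d' : measure_display) (T : measurableType d)
    (U : measurableType d') (S : countType) (g : T -> S) (F : S -> T -> U) :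
  (forall s, measurable (g @^-1` [set s])) ->
  (forall s, measurable_fun setT (F s)) ->
  measurable_fun setT (fun x => F (g x) x).
Proof.
move=> mg mF _ B mB; rewrite setTI.
have -> : (fun x => F (g x) x) @^-1` B =
  \bigcup_(s in [set: S]) (g @^-1` [set s] `&` F s @^-1` B).
  apply/seteqP; split => x /=; first by move=> Bx; exists (g x).
  by move=> [s _ [/= gs]]; rewrite gs.
apply: countable_bigcupT_measurable => //.
move=> s; apply: measurableI => //; rewrite -[X in measurable X]setTI; exact: mF.
Qed.

Lemma cvg_rV (R : realType) (d : nat) (u : nat -> 'rV[R]_d) (l : 'rV[R]_d) :
  (forall j, u n 0 j @[n --> \oo] --> l 0 j) -> u n @[n --> \oo] --> l.
Proof.
move=> ul; apply/cvgrPdist_lt => e e0.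
have : \forall n \near \oo, forall j, `|l 0 j - u n 0 j| < e.
  apply: filter_forall => j.
  by move/cvgrPdist_lt : (ul j); apply.
apply: filterS => n h.
rewrite /Num.norm /= mx_normrE; apply: bigmax_lt => // -[i j] _ /=.
by rewrite !mxE ord1.
Qed.

(* ['rV[R]_d] carries no sigma-algebra here: [f (W x)] is the limit of [f] at the
   roundings of [W x] to the countable grids [n.+1^-1 * Z^d]. *)
Lemma measurable_continuous_rV (R : realType) (dT : measure_display)
    (T : measurableType dT) (d : nat) (f : 'rV[R]_d -> R) (W : T -> 'rV[R]_d) :
  continuous f -> (forall j, measurable_fun setT (fun x => W x 0 j)) ->
  measurable_fun setT (fun x => f (W x)).
Proof.
move=> cf mW.
pose r (n : nat) (x : R) : R := (Num.floor (x * n.+1%:R))%:~R / n.+1%:R.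
have rcvg x : r n x @[n --> \oo] --> x.
  apply/cvgrPdist_lt => e e0; near=> n.
  have n0 : (0 : R) < n.+1%:R by [].
  have /andP[h1 h2] := floor_itv (x * n.+1%:R).
  have -> : x - r n x = (x * n.+1%:R - (Num.floor (x * n.+1%:R))%:~R) / n.+1%:R.
    by rewrite /r mulrBl mulfK ?gt_eqF.
  rewrite ger0_norm ?divr_ge0 ?subr_ge0//.
  apply: (@le_lt_trans _ _ (n.+1%:R^-1)).
    rewrite ler_pdivrMr// mulVf ?gt_eqF// lerBlDl.
    by move: h2; rewrite intrD => /ltW.
  near: n; exact: near_infty_natSinv_lt (PosNum e0).
pose Wn n x : 'rV[R]_d := map_mx (r n) (W x).
apply: (@measurable_fun_cvg _ _ _ _ (fun n x => f (Wn n x))); last first.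
  move=> x _; apply: (@cvg_comp _ _ _ (fun n => Wn n x) f) (cf (W x)).
  by apply: cvg_rV => j; under eq_fun do rewrite mxE; exact: rcvg.
move=> n.
pose gz x : {ffun 'I_d -> int} := [ffun j => Num.floor (W x 0 j * n.+1%:R)].
have -> : (fun x => f (Wn n x)) =
  (fun x => (fun (z : {ffun 'I_d -> int}) (_ : T) =>
     f (\row_j ((z j)%:~R / n.+1%:R))) (gz x) x).
  by apply/funext => x; congr f; apply/rowP => j; rewrite !mxE ffunE.
apply: (measurable_fun_countable _ _ _ _ _ gz (fun z _ =>
  f (\row_j ((z j)%:~R / n.+1%:R)))) => // z.
(* The fibre of a grid point is a box: one half-open interval per coordinate. *)
have -> : gz @^-1` [set z] = \bigcap_(j in [set` enum 'I_d])
   (setT `&` (fun x => W x 0 j) @^-1`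
     [set y | (z j)%:~R <= y * n.+1%:R < (z j + 1)%:~R]).
  apply/seteqP; split => x /=.
    move=> <- j _ /=; split => //; rewrite ffunE; exact: floor_itv.
  move=> h; apply/ffunP => j; rewrite ffunE; apply: floor_def.
  by have := h j; rewrite /= mem_enum => /(_ isT) [].
apply: fin_bigcap_measurable => // j _; apply: mW => //.
have -> : [set y | (z j)%:~R <= y * n.+1%:R < (z j + 1)%:~R] =
  `[((z j)%:~R : R) / n.+1%:R, (z j + 1)%:~R / n.+1%:R[%classic.
  apply/seteqP; split => y; rewrite /= in_itv /=;
  by rewrite ler_pdivrMr// ltr_pdivlMr.
exact: measurable_itv.
Unshelve. all: by end_near. Qed.

Lemma diff_coordE (R : realType) (d : nat) (f : 'rV[R]_d -> R)
    (w v : 'rV[R]_d) :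
  differentiable f w -> 'd f w v = \sum_j v 0 j * grad f w 0 j.
Proof.
move=> df; rewrite {1}(row_sum_delta v) linear_sum /=.
by apply: eq_bigr => j _; rewrite linearZ /= /grad mxE.
Qed.

(** Stated along the sequence [1/(n+1)] because measurability passes to limits of sequences; the
    convexity inequality uses the same sequence. *)
Lemma diff_quotient_cvg (R : realType) (d : nat) (f : 'rV[R]_d -> R)
    (w v : 'rV[R]_d) :
  differentiable f w ->
  n.+1%:R * (f (w + n.+1%:R^-1 *: v) - f w) @[n --> \oo] --> 'd f w v.
Proof.
move=> df; rewrite -deriveE//.
have dv : derivable f w v by exact: diff_derivable.
have hc : h^-1 *: ((f \o shift w) (h *: v) - f w) @[h --> 0^'] --> 'D_v f w.
  exact: dv.
have hn : (n.+1%:R^-1 : R) @[n --> \oo] --> 0^'.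
  move=> A [e /= e0 eA]; have [N _ hN] := near_infty_natSinv_lt (PosNum e0).
  exists N => // n /= Nn; apply: eA => /=; last by rewrite invr_eq0 pnatr_eq0.
  by rewrite sub0r normrN ger0_norm ?invr_ge0//; exact: hN.
have := cvg_comp _ _ hn hc; apply: cvg_trans; apply: near_eq_cvg.
near=> n; rewrite /= invrK; congr (_ * (f _ - _)); exact: addrC.
Unshelve. all: by end_near. Qed.

(** Each partial derivative is a pointwise limit of difference quotients of a continuous function,
    so it is measurable even where the gradient is discontinuous. *)
Lemma measurable_grad (R : realType) (dT : measure_display)
    (T : measurableType dT) (d : nat) (f : 'rV[R]_d -> R) (W : T -> 'rV[R]_d) :
  (forall w, differentiable f w) ->
  (forall j, measurable_fun setT (fun x => W x 0 j)) ->
  forall j, measurable_fun setT (fun x => grad f (W x) 0 j).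
Proof.
move=> df mW j.
have cf : continuous f by move=> w; exact: differentiable_continuous.
apply: (@measurable_fun_cvg _ _ _ _
  (fun n x => n.+1%:R * (f (W x + n.+1%:R^-1 *: delta_mx 0 j) - f (W x)))).
  move=> n; apply: measurable_funM => //; apply: measurable_funB.
    apply: (measurable_continuous_rV _ _ _ _ f) => // i.
    under eq_fun do rewrite mxE; apply: measurable_funD => //.
  exact: (measurable_continuous_rV _ _ _ _ f).
by move=> x _; rewrite /grad mxE; exact: diff_quotient_cvg.
Qed.

(** * Moments of the normal law *)

(** The change of density goes through the Radon-Nikodym derivative, which is identified with
    [normal_pdf] only almost everywhere, by comparing integrals over all measurable sets. *)
Lemma ge0_integral_normal_law (R : realType) (d : measure_display)
    (T : measurableType d) (P : probability T R) (Z : T -> R) (m s : R)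
    (f : R -> R) :
  measurable_fun setT Z ->
  (forall B : set R, measurable B -> P (Z @^-1` B) = normal_prob m s B) ->
  measurable_fun setT f -> (forall x, 0 <= f x) ->
  (\int[P]_x (f (Z x))%:E =
   \int[lebesgue_measure]_x (f x * normal_pdf m s x)%:E)%E.
Proof.
move=> mZ ZE mf f0; have dom := @normal_prob_dominates R m s.
have mf' : measurable_fun [set: measurableTypeR R] (EFin \o f).
  exact/measurable_EFinP.
have mZ' : measurable_fun setT (Z : T -> measurableTypeR R) by [].
have f0' : {in [set: measurableTypeR R], forall x, 0 <= (EFin \o f) x}%E.
  by move=> x _; rewrite lee_fin.
have <- := ge0_integral_pushforward mZ' P measurableT mf' f0'.
transitivity (\int[normal_prob m s]_x (f x)%:E)%E.
  by apply: eq_measure_integral => A mA _; exact: ZE.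
rewrite -(Radon_Nikodym_SigmaFinite.change_of_variables dom _ measurableT mf');
  last by move=> x; rewrite lee_fin.
have RNi := Radon_Nikodym_SigmaFinite.f_integrable dom.
have mpdf : measurable_fun [set: measurableTypeR R]
    (fun x => (normal_pdf m s x)%:E).
  by apply/measurable_EFinP; exact: measurable_normal_pdf.
apply: ge0_ae_eq_integral => //.
- by apply: emeasurable_funM => //; exact: measurable_int RNi.
- by apply/measurable_EFinP; apply: measurable_funM => //;
    exact: measurable_normal_pdf.
- move=> x _; rewrite mule_ge0 ?lee_fin//.
  exact: Radon_Nikodym_SigmaFinite.f_ge0.
- by move=> x _; rewrite lee_fin mulr_ge0// normal_pdf_ge0.
under [X in ae_eq _ _ _ X]eq_fun do rewrite EFinM.
apply: ae_eqe_mul2l.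
apply: integral_ae_eq => // A _ mA.
by rewrite -(Radon_Nikodym_SigmaFinite.f_integral dom).
Qed.

(** Turns a pointwise comparison of densities into a moment bound; the only Gaussian integral
    involved is the total mass 1 of N(m,s'^2). *)
Lemma normal_law_integral_le (R : realType) (d : measure_display)
    (T : measurableType d) (P : probability T R) (Z : T -> R) (s m s' K : R)
    (f : R -> R) :
  measurable_fun setT Z ->
  (forall B : set R, measurable B -> P (Z @^-1` B) = normal_prob 0 s B) ->
  0 <= K -> measurable_fun setT f -> (forall x, 0 <= f x) ->
  (forall x, f x * normal_pdf 0 s x <= K * normal_pdf m s' x) ->
  (\int[P]_x (f (Z x))%:E <= K%:E)%E.
Proof.
move=> mZ ZE K0 mf f0 fK; rewrite (ge0_integral_normal_law _ _ _ _ _ _ _ _ mZ ZE)//.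
apply: (@le_trans _ _
  (\int[lebesgue_measure]_x (K%:E * (normal_pdf m s' x)%:E))%E).
  apply: ge0_le_integral => //.
  - by move=> x _; rewrite lee_fin mulr_ge0// normal_pdf_ge0.
  - by apply/measurable_EFinP; apply: measurable_funM => //;
      exact: measurable_normal_pdf.
  - by apply/measurable_EFinP; apply: measurable_funM => //;
      exact: measurable_normal_pdf.
  - by move=> x _; rewrite -EFinM lee_fin.
rewrite integralZl//; last exact: integrable_normal_pdf.
by rewrite integral_normal_pdf mule1.
Qed.

Lemma normal_peakE (R : realType) (s : R) : 0 < s ->
  normal_peak s = s^-1 * (Num.sqrt (pi *+ 2))^-1.
Proof.
move=> s0; rewrite /normal_peak -mulrnAr sqrtrM ?sqr_ge0// sqrtr_sqr gtr0_norm//.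
by rewrite invfM.
Qed.

(* Compares the densities of N(0,s^2) and N(0,s'^2) through 1 + y <= e^y and
   uses that both have mass 1; letting s' tend to s gives the sharp bound. *)
Lemma normal_pdf_wider (R : realType) (s s' x : R) : 0 < s -> s < s' ->
  (1 + (s ^- 2 - s' ^- 2) / 2 * x ^+ 2) * normal_pdf 0 s x <=
  s' / s * normal_pdf 0 s' x.
Proof.
move=> s0 ss'; have s'0 : 0 < s' by exact: lt_trans ss'.
rewrite !normal_pdfE ?gt_eqF// !normal_peakE// /normal_fun !subr0.
set p := (Num.sqrt _)^-1.
have p0 : 0 <= p by rewrite invr_ge0 sqrtr_ge0.
have -> : s' / s * (s'^-1 * p * expR (- x ^+ 2 / (s' ^+ 2 *+ 2))) =
          s^-1 * p * expR (- x ^+ 2 / (s' ^+ 2 *+ 2)).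
  by field; rewrite !gt_eqF.
rewrite mulrCA; apply: ler_wpM2l; first by rewrite mulr_ge0// invr_ge0 ltW.
have -> : - x ^+ 2 / (s' ^+ 2 *+ 2) =
  (s ^- 2 - s' ^- 2) / 2 * x ^+ 2 + - x ^+ 2 / (s ^+ 2 *+ 2).
  by field; rewrite !gt_eqF.
by rewrite expRD; apply: ler_wpM2r; [exact: expR_ge0|exact: expR_ge1Dx].
Qed.

(** The ratio of the two densities is [e^y] with [y = (x m - m^2/2) / s^2], and [1 + y <= e^y]. *)
Lemma normal_pdf_shift (R : realType) (s m x : R) : 0 < s ->
  (1 + (x * m - m ^+ 2 / 2) / s ^+ 2) * normal_pdf 0 s x <= normal_pdf m s x.
Proof.
move=> s0; rewrite !normal_pdfE ?gt_eqF// /normal_fun.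
rewrite mulrCA; apply: ler_wpM2l; first exact: normal_peak_ge0.
have -> : - (x - m) ^+ 2 / (s ^+ 2 *+ 2) =
  (x * m - m ^+ 2 / 2) / s ^+ 2 + - (x - 0) ^+ 2 / (s ^+ 2 *+ 2).
  by field; rewrite gt_eqF.
by rewrite expRD; apply: ler_wpM2r; [exact: expR_ge0|exact: expR_ge1Dx].
Qed.

Lemma normal_law_second_moment (R : realType) (d : measure_display)
    (T : measurableType d) (P : probability T R) (Z : T -> R) (s : R) :
  0 < s -> measurable_fun setT Z ->
  (forall B : set R, measurable B -> P (Z @^-1` B) = normal_prob 0 s B) ->
  (\int[P]_x (Z x ^+ 2)%:E <= (s ^+ 2)%:E)%E.
Proof.
move=> s0 mZ ZE.
have mZ2 : measurable_fun setT (fun x => (Z x ^+ 2)%:E).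
  by apply/measurable_EFinP; exact: measurable_funX.
have J0 : (0 <= \int[P]_x (Z x ^+ 2)%:E)%E.
  by apply: integral_ge0 => x _; rewrite lee_fin sqr_ge0.
(* Integrating [normal_pdf_wider] gives [1 + c E Z^2 <= s'/s], and solving for [E Z^2] yields this
   bound, which tends to [s^2] as [s'] decreases to [s]. *)
have key s' : s < s' -> (\int[P]_x (Z x ^+ 2)%:E <= (s * s' ^+ 2 * 2 / (s' + s))%:E)%E.
  move=> ss'; have s'0 : 0 < s' by exact: lt_trans ss'.
  pose c := (s ^- 2 - s' ^- 2) / 2.
  have c0 : 0 < c.
    apply: divr_gt0 => //; rewrite subr_gt0 ltf_pV2 ?posrE ?exprn_gt0//.
    by rewrite ltr_pXn2r ?nnegrE ?ltW.
  have : (\int[P]_x (1 + c * Z x ^+ 2)%:E <= (s' / s)%:E)%E.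
    apply: (normal_law_integral_le _ _ _ _ _ s 0 s' (s' / s)
      (fun x => 1 + c * x ^+ 2) mZ ZE).
    - by rewrite divr_ge0// ltW.
    - by apply: measurable_funD => //; apply: measurable_funM => //;
      exact: measurable_funX.
    - by move=> x; rewrite addr_ge0// mulr_ge0 ?sqr_ge0// ltW.
    - by move=> x; exact: normal_pdf_wider.
  under eq_integral do rewrite EFinD EFinM.
  rewrite ge0_integralD//; last 2 first.
  - by move=> x _; rewrite mule_ge0 ?lee_fin ?sqr_ge0 ?ltW.
  - by apply: emeasurable_funM => //; exact: measurable_cst.
  rewrite ge0_integralZl//; last 2 first.
  - by move=> x _; rewrite lee_fin sqr_ge0.
  - by rewrite lee_fin ltW.
  have -> : (\int[P]_x 1 = 1)%E.
    by rewrite integral_cst// mul1e; exact: probability_setT.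
  case: (\int[P]_x (Z x ^+ 2)%:E)%E J0 => [r| |]//; last first.
    by move=> _; rewrite gt0_muley ?lte_fin// addey// leye_eq.
  rewrite !lee_fin => r0 h.
  have {h} h : c * r <= (s' - s) / s.
    by rewrite mulrBl divff ?gt_eqF// lerBrDl.
  rewrite -(ler_pM2l c0); apply: (le_trans h); rewrite le_eqVlt; apply/orP; left.
  by apply/eqP; rewrite /c; field; rewrite !gt_eqF// addr_gt0.
apply/lee_addgt0Pr => e e0.
rewrite -EFinD.
(* With this choice the bound of [key] is at most [s'^2 = s^2 + e], since [2 s <= s' + s]. *)
pose s' := Num.sqrt (s ^+ 2 + e).
have se0 : 0 < s ^+ 2 + e by rewrite addr_gt0// exprn_gt0.
have ss' : s < s'.
  rewrite -[ltLHS]gtr0_norm// -sqrtr_sqr ltr_sqrt//.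
  by rewrite ltrDl.
have s'0 : 0 < s' by exact: lt_trans ss'.
apply: (le_trans (key _ ss')); rewrite lee_fin.
rewrite -(sqr_sqrtr (ltW se0)) -/s' ler_pdivrMr ?addr_gt0//.
have -> : s * s' ^+ 2 * 2 = s' ^+ 2 * (s + s) by ring.
by rewrite ler_wpM2l ?sqr_ge0// lerD2r ltW.
Qed.

(* The mean vanishes because [exp] dominates its tangent: the mass of
   N(m,s^2) gives [m * E Z <= m^2 / 2] for every shift [m]. *)
Lemma normal_law_moments (R : realType) (d : measure_display)
    (T : measurableType d) (P : probability T R) (Z : T -> R) (s : R) :
  0 < s -> measurable_fun setT Z ->
  (forall B : set R, measurable B -> P (Z @^-1` B) = normal_prob 0 s B) ->
  [/\ P.-integrable setT (EFin \o Z), \int[P]_x Z x = 0,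
      P.-integrable setT (EFin \o (fun x => Z x ^+ 2)) &
      \int[P]_x (Z x ^+ 2) <= s ^+ 2].
Proof.
move=> s0 mZ ZE.
have h2 := normal_law_second_moment _ _ _ _ _ _ s0 mZ ZE.
have c1 (c : R) : P.-integrable setT (EFin \o (fun=> c)).
  exact: finite_measure_integrable_cst.
have iZ2 : P.-integrable setT (EFin \o (fun x => Z x ^+ 2)).
  apply/integrableP; split; first exact/measurable_EFinP/measurable_funX.
  under eq_integral do rewrite /= ger0_norm ?sqr_ge0//.
  exact: le_lt_trans h2 (ltry _).
have iZ : P.-integrable setT (EFin \o Z).
  have i2 : P.-integrable setT (EFin \o (fun x => 1 + Z x ^+ 2)).
    exact: (integrableD measurableT (c1 1) iZ2).
  apply: le_integrable i2 => //; first exact/measurable_EFinP.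
  move=> x _; rewrite /= lee_fin [X in _ <= X]ger0_norm ?addr_ge0 ?sqr_ge0//.
  by have [x0|x0] := ger0P (Z x); nra.
split => //; last first.
  by rewrite -lee_fin fineK//; exact: integrable_fin_num.
set J := \int[_]_x Z x.
have key m : m * J <= m ^+ 2 / 2.
  pose g (x : R) := 1 + (x * m - m ^+ 2 / 2) / s ^+ 2.
  have mg : measurable_fun setT g.
    apply: measurable_funD => //; apply: measurable_funM => //.
    by apply: measurable_funB => //; exact: measurable_funM.
  have mgZ : measurable_fun setT (fun x => g (Z x)).
    exact: measurableT_comp.
  (* The tangent [g] takes negative values, while the density comparison is for nonnegative
     integrands; its positive part is still dominated, and it lies above [g]. *)
  have h : (\int[P]_x (Num.max 0 (g (Z x)))%:E <= 1%:E)%E.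
    apply: (normal_law_integral_le _ _ _ _ _ s m s 1 (fun x => Num.max 0 (g x))
      mZ ZE) => //.
    - exact: measurable_maxr.
    - by move=> x; rewrite le_max lexx.
    move=> x; rewrite mul1r maxr_pMl ?normal_pdf_ge0// mul0r ge_max.
    by rewrite normal_pdf_ge0 normal_pdf_shift.
  have ig : P.-integrable setT (EFin \o (fun x => g (Z x))).
    have -> : EFin \o (fun x => g (Z x)) =
        (fun x => (1 - m ^+ 2 / 2 / s ^+ 2)%:E + (m / s ^+ 2)%:E * (Z x)%:E)%E.
      by apply/funext => x; rewrite /= -!EFinM -EFinD /g; congr EFin; field;
        rewrite gt_eqF.
    exact: (integrableD measurableT (c1 _)
      (integrableZl measurableT (m / s ^+ 2) iZ)).
  have : \int[P]_x g (Z x) <= 1.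
    rewrite -lee_fin fineK; last exact: integrable_fin_num.
    apply: le_trans h; apply: le_integral => //.
      apply: le_integrable ig => //.
        by apply/measurable_EFinP; exact: measurable_maxr.
      by move=> x _; rewrite /= lee_fin; case: (leP 0 (g (Z x))) => ?;
        rewrite ?normr0.
    by move=> x _; rewrite lee_fin le_max lexx orbT.
  have -> : \int[P]_x g (Z x) = 1 - m ^+ 2 / 2 / s ^+ 2 + m / s ^+ 2 * J.
    transitivity (\int[P]_x ((1 - m ^+ 2 / 2 / s ^+ 2) + m / s ^+ 2 * Z x)).
      by apply: eq_Rintegral => x _; rewrite /g; field; rewrite gt_eqF.
    rewrite RintegralD//; last exact: (integrableZl measurableT (m / s ^+ 2) iZ).
    rewrite RintegralZl// Rintegral_cst//.
    have -> : fine (P setT) = 1 by rewrite probability_setT.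
    by rewrite mulr1.
  rewrite -subr_ge0 => h3.
  have : 0 <= s ^+ 2 * (1 - (1 - m ^+ 2 / 2 / s ^+ 2 + m / s ^+ 2 * J)).
    by rewrite mulr_ge0 ?sqr_ge0.
  have -> : s ^+ 2 * (1 - (1 - m ^+ 2 / 2 / s ^+ 2 + m / s ^+ 2 * J)) =
    m ^+ 2 / 2 - m * J by field; rewrite gt_eqF.
  by rewrite subr_ge0.
(* The shift [m = J] gives [J^2 <= J^2 / 2], which forces [J = 0]. *)
have := key J => h; apply/eqP; rewrite -sqrf_eq0 eq_le sqr_ge0 andbT.
by move: h; rewrite -expr2; nra.
Qed.

(** * Clipping and convexity *)

Definition dotp {R : realType} {d : nat} (u v : 'rV[R]_d) : R :=
  \sum_(j < d) u 0 j * v 0 j.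

Lemma dotpC (R : realType) (d : nat) (u v : 'rV[R]_d) : dotp u v = dotp v u.
Proof. by apply: eq_bigr => j _; rewrite mulrC. Qed.

Lemma dotpDl (R : realType) (d : nat) (u v w : 'rV[R]_d) :
  dotp (u + v) w = dotp u w + dotp v w.
Proof. by rewrite -big_split; apply: eq_bigr => j _; rewrite mxE mulrDl. Qed.

Lemma dotpZl (R : realType) (d : nat) (a : R) (u v : 'rV[R]_d) :
  dotp (a *: u) v = a * dotp u v.
Proof. by rewrite mulr_sumr; apply: eq_bigr => j _; rewrite mxE mulrA. Qed.

Lemma dotpNl (R : realType) (d : nat) (u v : 'rV[R]_d) :
  dotp (- u) v = - dotp u v.
Proof. by rewrite -scaleN1r dotpZl mulN1r. Qed.

Lemma dotpBl (R : realType) (d : nat) (u v w : 'rV[R]_d) :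
  dotp (u - v) w = dotp u w - dotp v w.
Proof. by rewrite dotpDl dotpNl. Qed.

Lemma dotpDr (R : realType) (d : nat) (u v w : 'rV[R]_d) :
  dotp w (u + v) = dotp w u + dotp w v.
Proof. by rewrite dotpC dotpDl !(dotpC _ _ w). Qed.

Lemma dotpZr (R : realType) (d : nat) (a : R) (u v : 'rV[R]_d) :
  dotp u (a *: v) = a * dotp u v.
Proof. by rewrite dotpC dotpZl dotpC. Qed.

Lemma dotpBr (R : realType) (d : nat) (u v w : 'rV[R]_d) :
  dotp w (u - v) = dotp w u - dotp w v.
Proof. by rewrite dotpC dotpBl !(dotpC _ _ w). Qed.

Lemma dotp0l (R : realType) (d : nat) (u : 'rV[R]_d) : dotp 0 u = 0.
Proof. by rewrite -(scale0r 0) dotpZl mul0r. Qed.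

Lemma dotp_suml (R : realType) (d : nat) (I : finType) (P : pred I)
    (F : I -> 'rV[R]_d) (v : 'rV[R]_d) :
  dotp (\sum_(i | P i) F i) v = \sum_(i | P i) dotp (F i) v.
Proof.
elim/big_rec2 : _ => [|i y1 y2 _ IH]; first by rewrite dotp0l.
by rewrite dotpDl IH.
Qed.

Lemma dotp_ge0 (R : realType) (d : nat) (u : 'rV[R]_d) : 0 <= dotp u u.
Proof. by apply: sumr_ge0 => j _; rewrite -expr2 sqr_ge0. Qed.

Lemma enorm_ge0 (R : realType) (d : nat) (u : 'rV[R]_d) : 0 <= enorm u.
Proof. exact: sqrtr_ge0. Qed.

Lemma sqr_enorm (R : realType) (d : nat) (u : 'rV[R]_d) :
  enorm u ^+ 2 = dotp u u.
Proof. by rewrite sqr_sqrtr ?sumr_ge0// => j _; exact: sqr_ge0. Qed.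

Lemma dotp_CS (R : realType) (d : nat) (u v : 'rV[R]_d) :
  `|dotp u v| <= enorm u * enorm v.
Proof.
rewrite -ler_sqr ?nnegrE ?mulr_ge0 ?enorm_ge0//.
rewrite real_normK ?num_real// exprMn !sqr_enorm.
set A := dotp u u; set B := dotp v v; set P := dotp u v.
(* This is the squared length of [B u - P v], a multiple of the component of [u] orthogonal to [v],
   written without dividing by [B]. *)
have : 0 <= B * (A * B - P ^+ 2).
  have -> : B * (A * B - P ^+ 2) = dotp (B *: u - P *: v) (B *: u - P *: v).
    rewrite dotpBl !dotpBr !dotpZl !dotpZr (dotpC _ _ v u) -/A -/B -/P; ring.
  exact: dotp_ge0.
have [B0|B0] := ltP 0 B; first by rewrite pmulr_rge0// subr_ge0.
have vB : B = 0 by apply/eqP; rewrite eq_le B0 dotp_ge0.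
move=> _; have v0 j : v 0 j = 0.
  move: vB => /eqP; rewrite psumr_eq0; last by move=> i _; rewrite -expr2 sqr_ge0.
  by move/allP => /(_ j (mem_index_enum _)) /=; rewrite mulf_eq0 orbb => /eqP.
have -> : P = 0 by rewrite /P /dotp big1// => j _; rewrite v0 mulr0.
by rewrite expr0n mulr_ge0// dotp_ge0.
Qed.

Lemma enormZ (R : realType) (d : nat) (a : R) (u : 'rV[R]_d) :
  enorm (a *: u) = `|a| * enorm u.
Proof.
apply/eqP; rewrite -(@eqrXn2 _ 2%N)// ?mulr_ge0 ?enorm_ge0//.
by rewrite exprMn !sqr_enorm dotpZl dotpZr real_normK ?num_real// mulrA expr2.
Qed.

Lemma enormD (R : realType) (d : nat) (u v : 'rV[R]_d) :
  enorm (u + v) <= enorm u + enorm v.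
Proof.
rewrite -ler_sqr ?nnegrE ?addr_ge0 ?enorm_ge0// sqr_enorm sqrrD !sqr_enorm.
rewrite dotpDl !dotpDr (dotpC _ _ v u).
have := le_trans (ler_norm _) (dotp_CS _ _ u v); lra.
Qed.

Lemma enorm_sum (R : realType) (d : nat) (I : finType) (P : pred I)
    (F : I -> 'rV[R]_d) :
  enorm (\sum_(i | P i) F i) <= \sum_(i | P i) enorm (F i).
Proof.
elim/big_rec2 : _ => [|i y1 y2 _ IH].
  by rewrite -(scale0r 0) enormZ normr0 mul0r.
by apply: le_trans (enormD _ _ _ _) _; rewrite lerD2l.
Qed.

Lemma clip_factor_ge0 (R : realType) (d : nat) (z : 'rV[R]_d) (c : R) :
  0 < c -> 0 <= Num.min 1 (c / enorm z).
Proof. by move=> c0; rewrite le_min ler01 divr_ge0 ?enorm_ge0 ?ltW. Qed.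

Lemma enorm_clip (R : realType) (d : nat) (z : 'rV[R]_d) (c : R) :
  0 < c -> enorm (clip z c) <= c.
Proof.
move=> c0; rewrite enormZ ger0_norm ?clip_factor_ge0//.
have := enorm_ge0 _ _ z; rewrite le_eqVlt => /orP[/eqP <-|z0].
  by rewrite mulr0 ltW.
by rewrite -ler_pdivlMr// ge_min lexx orbT.
Qed.

(** Clipping changes [z] only when its norm exceeds [c]. The part removed then has norm at most
    [|z| = |z|^k |z|^(1-k) <= g^k c^(1-k)], because the exponent [1 - k] is negative. *)
Lemma clip_bias (R : realType) (d : nat) (z u : 'rV[R]_d) (c g k : R) :
  0 < c -> 1 < k -> enorm z <= g ->
  dotp (z - clip z c) u <= g `^ k * c `^ (1 - k) * enorm u.
Proof.
move=> c0 k1 zg; have k0 : 0 < k by exact: lt_trans k1.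
apply: le_trans (ler_norm _) _; apply: le_trans (dotp_CS _ _ _ _) _.
apply: ler_wpM2r; first exact: enorm_ge0.
rewrite /clip -{1}(scale1r z) -scalerBl enormZ.
have := enorm_ge0 _ _ z; rewrite le_eqVlt => /orP[/eqP z0|z0].
  by rewrite -z0 mulr0 mulr_ge0 ?powR_ge0.
have [cz|cz] := leP c (enorm z); last first.
  by rewrite min_l ?subrr ?normr0 ?mul0r ?mulr_ge0 ?powR_ge0// ler_pdivlMr// mul1r ltW.
have lz : Num.min 1 (c / enorm z) <= 1 by rewrite ge_min lexx.
rewrite ger0_norm ?subr_ge0//.
have e1 : enorm z = enorm z `^ k * enorm z `^ (1 - k).
  by rewrite -powRD ?subrKC ?powRr1 ?ltW//; apply/implyP => _; rewrite gt_eqF.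
apply: (@le_trans _ _ (enorm z)).
  apply: ler_piMl; first exact: enorm_ge0.
  by rewrite gerBl clip_factor_ge0.
rewrite e1 ler_pM ?powR_ge0//.
  apply: ge0_ler_powR; rewrite ?nnegrE ?enorm_ge0//; first exact: ltW.
  exact: le_trans (enorm_ge0 _ _ z) zg.
have -> : 1 - k = - (k - 1) by rewrite opprB.
rewrite !powRN lef_pV2 ?posrE ?powR_gt0//.
by apply: ge0_ler_powR; rewrite ?nnegrE ?subr_ge0 ?(ltW c0) ?(ltW z0) ?(ltW k1).
Qed.

(** Convexity bounds every secant slope of the mean along [v], taken with step [1/(N+1)], by the
    full increment; the slopes converge to the directional derivative. *)
Lemma convex_mean_gradient (R : realType) (d n : nat)
    (fi : 'I_n -> 'rV[R]_d -> R) (w v : 'rV[R]_d) :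
  (forall i w, differentiable (fi i) w) ->
  convex_fun (fun w => n%:R^-1 * \sum_(i < n) fi i w) ->
  n%:R^-1 * \sum_(i < n) dotp v (grad (fi i) w) <=
  n%:R^-1 * \sum_(i < n) fi i (w + v) - n%:R^-1 * \sum_(i < n) fi i w.
Proof.
move=> df cf; set f := fun w => n%:R^-1 * \sum_(i < n) fi i w.
have dq : N.+1%:R * (f (w + N.+1%:R^-1 *: v) - f w) @[N --> \oo] -->
   n%:R^-1 * \sum_(i < n) dotp v (grad (fi i) w).
  have -> : (fun N => N.+1%:R * (f (w + N.+1%:R^-1 *: v) - f w)) =
    (fun N => n%:R^-1 * \sum_(i < n)
      (N.+1%:R * (fi i (w + N.+1%:R^-1 *: v) - fi i w))).
    apply/funext => N; rewrite /f -mulrBr mulrCA; congr (_ * _).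
    by rewrite -mulr_sumr big_split sumrN.
  apply: cvgMl_tmp; apply: cvg_big => [|i _]; first by move=> ?; exact: add_continuous.
  have -> : dotp v (grad (fi i) w) = 'd (fi i) w v by rewrite diff_coordE.
  exact: diff_quotient_cvg.
apply: (cvgr_to_le dq); apply: nearW => N.
have N0 : 0 < N.+1%:R :> R by [].
have N1 : N.+1%:R^-1 <= 1 :> R by rewrite invf_le1// ler1n.
have := cf (w + v) w N.+1%:R^-1; rewrite -/f => /(_ _ N1).
rewrite invr_ge0 ler0n => /(_ isT).
have -> : N.+1%:R^-1 *: (w + v) + (1 - N.+1%:R^-1) *: w = w + N.+1%:R^-1 *: v.
  by rewrite scalerDr scalerBl scale1r addrC addrA subrK.
move=> h; rewrite -(ler_pM2l (_ : 0 < N.+1%:R^-1)) ?invr_gt0// mulKf ?gt_eqF//.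
rewrite lerBlDr; apply: le_trans h _.
by rewrite le_eqVlt; apply/orP; left; apply/eqP; rewrite /f; ring.
Qed.

Lemma clipped_descent (R : realType) (d n : nat)
    (fi : 'I_n -> 'rV[R]_d -> R) (wstar w : 'rV[R]_d) (Gi : 'I_n -> R)
    (tau k beta Dc : R) :
  (0 < n)%N -> 0 < tau -> 1 < k -> 0 <= beta -> 0 < Dc ->
  let f := fun w => n%:R^-1 * \sum_(i < n) fi i w in
  (forall i w, differentiable (fi i) w) -> convex_fun f ->
  (forall w, f wstar <= f w) ->
  (forall w, Dc < enorm (w - wstar) ->
     2 * beta * enorm (w - wstar) < f w - f wstar) ->
  (forall i w, enorm (grad (fi i) w) <= Gi i) ->
  n%:R^-1 * \sum_(i < n) (Gi i `^ k * tau `^ (1 - k)) <= beta ->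
  f w - f wstar <=
  2 * (n%:R^-1 * \sum_(i < n) dotp (clip (grad (fi i) w) tau) (w - wstar))
  + 2 * beta * Dc.
Proof.
move=> n0 tau0 k1 b0 D0 f df cf fmin fD gG Gb.
set u := w - wstar; set c := n%:R^-1 * _.
have n0' : 0 <= n%:R^-1 :> R by rewrite invr_ge0.
(* Inside the ball the bound on the gap is doubled, which is legitimate because the gap is
   nonnegative; both cases then end in the same inequality. *)
have h0 : 0 <= f w - f wstar by rewrite subr_ge0.
have h : f w - f wstar <= c + beta * enorm u.
  have := convex_mean_gradient _ _ _ fi w (- u) df cf.
  have -> : w - u = wstar by rewrite /u subKr.
  rewrite -/(f _) -/(f _) => h1.
  have {}h1 : f w - f wstar <= n%:R^-1 * \sum_(i < n) dotp (grad (fi i) w) u.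
    rewrite -lerN2 opprB; apply: le_trans h1.
    rewrite -mulrN ler_wpM2l// -sumrN ler_sum// => i _.
    by rewrite dotpNl dotpC.
  apply: (le_trans h1); rewrite -lerBlDl /c -mulrBr -sumrB.
  apply: (@le_trans _ _ (n%:R^-1 * \sum_(i < n) (Gi i `^ k * tau `^ (1 - k) * enorm u))).
    rewrite ler_wpM2l// ler_sum// => i _; rewrite -dotpBl.
    exact: clip_bias.
  by rewrite -mulr_suml mulrA ler_wpM2r// enorm_ge0.
have [uD|uD] := leP (enorm u) Dc; last first.
  have := fD w uD; rewrite -/u => h2.
  have : 0 <= beta * Dc by rewrite mulr_ge0// ltW.
  lra.
have : beta * enorm u <= beta * Dc by rewrite ler_wpM2l.
lra.
Qed.

Lemma sqr_enormB (R : realType) (d : nat) (a : R) (u v : 'rV[R]_d) :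
  enorm (u - a *: v) ^+ 2 =
  enorm u ^+ 2 - 2 * a * dotp u v + a ^+ 2 * enorm v ^+ 2.
Proof.
rewrite !sqr_enorm dotpBl !dotpBr !dotpZl !dotpZr (dotpC _ _ v u); ring.
Qed.

(** * One noisy step *)

(** The real-valued integral is total and reads an infinite integral as 0, so the value is bundled
    with integrability. *)
Definition has_mean {R : realType} {d} {T : measurableType d}
    (P : probability T R) (f : T -> R) (v : R) : Prop :=
  P.-integrable setT (EFin \o f) /\ \int[P]_x f x = v.

Lemma has_mean_cst (R : realType) (d : measure_display) (T : measurableType d)
    (P : probability T R) (c : R) : has_mean P (fun=> c) c.
Proof.
split; first exact: finite_measure_integrable_cst.
rewrite Rintegral_cst//.
have -> : fine (P setT) = 1 by rewrite probability_setT.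
by rewrite mulr1.
Qed.

Lemma has_meanD (R : realType) (d : measure_display) (T : measurableType d)
    (P : probability T R) (f g : T -> R) (a b : R) :
  has_mean P f a -> has_mean P g b -> has_mean P (fun x => f x + g x) (a + b).
Proof.
by move=> [if_ <-] [ig <-]; split; [exact: (integrableD measurableT if_ ig)|rewrite RintegralD].
Qed.

Lemma has_meanZ (R : realType) (d : measure_display) (T : measurableType d)
    (P : probability T R) (c : R) (f : T -> R) (a : R) :
  has_mean P f a -> has_mean P (fun x => c * f x) (c * a).
Proof.
move=> [if_ <-]; split; last by rewrite RintegralZl.
exact: (integrableZl measurableT c if_).
Qed.

Lemma has_meanB (R : realType) (d : measure_display) (T : measurableType d)
    (P : probability T R) (f g : T -> R) (a b : R) :
  has_mean P f a -> has_mean P g b -> has_mean P (fun x => f x - g x) (a - b).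
Proof.
by move=> [if_ <-] [ig <-]; split; [exact: (integrableB measurableT if_ ig)|rewrite RintegralB].
Qed.

Lemma has_mean_sum (R : realType) (d : measure_display) (T : measurableType d)
    (P : probability T R) (I : Type) (s : seq I) (f : I -> T -> R)
    (a : I -> R) :
  (forall i, has_mean P (f i) (a i)) ->
  has_mean P (fun x => \sum_(i <- s) f i x) (\sum_(i <- s) a i).
Proof.
move=> fa; elim: s => [|i s IH].
  rewrite big_nil; under eq_fun do rewrite big_nil; exact: has_mean_cst.
rewrite big_cons; under eq_fun do rewrite big_cons; exact: has_meanD.
Qed.

Lemma has_mean_integrable (R : realType) (d : measure_display)
    (T : measurableType d) (P : probability T R) (f : T -> R) :
  P.-integrable setT (EFin \o f) -> has_mean P f (\int[P]_x f x).
Proof. by []. Qed.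

Lemma has_mean_le (R : realType) (d : measure_display) (T : measurableType d)
    (P : probability T R) (f g : T -> R) (a b : R) :
  has_mean P f a -> has_mean P g b -> (forall x, f x <= g x) -> a <= b.
Proof. by move=> [if_ <-] [ig <-] fg; exact: le_Rintegral. Qed.

Lemma dominated_integrable (R : realType) (d : measure_display)
    (T : measurableType d) (P : probability T R) (f g : T -> R) (b : R) :
  measurable_fun setT f -> has_mean P g b -> (forall x, `|f x| <= g x) ->
  P.-integrable setT (EFin \o f).
Proof.
move=> mf [ig _] fg; apply: le_integrable ig => //.
  exact/measurable_EFinP.
move=> x _; rewrite /= lee_fin [leRHS]ger0_norm//.
exact: le_trans (normr_ge0 (f x)) (fg x).
Qed.

Lemma has_meanM (R : realType) (d : measure_display) (T : measurableType d)
    (P : probability T R) (f g : T -> R) (a b : R) :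
  measurable_fun setT f -> measurable_fun setT g -> indep2 P f g ->
  has_mean P f a -> has_mean P g b -> has_mean P (fun x => f x * g x) (a * b).
Proof.
move=> mf mg fg [if_ <-] [ig <-].
exact: (indep2_integralM _ _ _ _ _ _ mf mg fg if_ ig).
Qed.

Lemma measurable_bool_natr (R : realType) (d : measure_display)
    (T : measurableType d) (m : T -> bool) :
  measurable_fun setT m -> measurable_fun setT (fun x => (m x)%:R : R).
Proof.
move=> mm; apply: (@measurableT_comp _ _ _ _ _ _ (fun b : bool => b%:R : R)) => //.
Qed.

Lemma has_mean_bool (R : realType) (d : measure_display) (T : measurableType d)
    (P : probability T R) (m : T -> bool) (p : R) :
  measurable_fun setT m -> P (m @^-1` [set true]) = p%:E ->
  has_mean P (fun x => (m x)%:R) p.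
Proof.
move=> mm Pm.
have mA : measurable (m @^-1` [set true]).
  by rewrite -[X in measurable X]setTI; exact: mm.
have mE : (fun x => (m x)%:R) = \1_(m @^-1` [set true]) :> (T -> R).
  apply/funext => x; rewrite indicE.
  case: (boolP (x \in _)) => [/set_mem /= -> //|/negP h].
  by case E: (m x) => //; case: h; exact/mem_set.
rewrite mE; split; first exact: integrable_indic.
by rewrite /Rintegral integral_indic// setIT; exact: (congr1 fine Pm).
Qed.

Lemma measurable_dotp (R : realType) (dT : measure_display)
    (T : measurableType dT) (d : nat) (u v : T -> 'rV[R]_d) :
  (forall j, measurable_fun setT (fun x => u x 0 j)) ->
  (forall j, measurable_fun setT (fun x => v x 0 j)) ->
  measurable_fun setT (fun x => dotp (u x) (v x)).
Proof.
by move=> mu mv; apply: measurable_sum => j; exact: measurable_funM.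
Qed.

Lemma measurable_enorm (R : realType) (dT : measure_display)
    (T : measurableType dT) (d : nat) (u : T -> 'rV[R]_d) :
  (forall j, measurable_fun setT (fun x => u x 0 j)) ->
  measurable_fun setT (fun x => enorm (u x)).
Proof.
move=> mu.
have -> : (fun x => enorm (u x)) = (fun x => (dotp (u x) (u x)) `^ 2^-1).
  by apply/funext => x; rewrite powR12_sqrt ?dotp_ge0.
apply: (@measurableT_comp _ _ _ _ _ _ (fun y : R => y `^ 2^-1)) => //.
exact: measurable_dotp.
Qed.

Lemma measurable_clip (R : realType) (dT : measure_display)
    (T : measurableType dT) (d : nat) (u : T -> 'rV[R]_d) (c : R) :
  (forall j, measurable_fun setT (fun x => u x 0 j)) ->
  forall j, measurable_fun setT (fun x => clip (u x) c 0 j).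
Proof.
move=> mu j.
have -> : (fun x => clip (u x) c 0 j) =
    (fun x => Num.min 1 (c * (enorm (u x)) `^ (-1)) * u x 0 j).
  by apply/funext => x; rewrite mxE powR_inv1 ?enorm_ge0.
apply: measurable_funM => //; apply: measurable_minr => //.
apply: measurable_funM => //.
apply: (@measurableT_comp _ _ _ _ _ _ (fun y : R => y `^ (-1))) => //.
exact: measurable_enorm.
Qed.

Lemma coord_le_enorm (R : realType) (d : nat) (u : 'rV[R]_d) j :
  `|u 0 j| <= enorm u.
Proof.
rewrite -ler_sqr ?nnegrE ?enorm_ge0// real_normK ?num_real// sqr_enorm /dotp.
rewrite (bigD1 j)//= -expr2 lerDl; apply: sumr_ge0 => i _.
by rewrite -expr2 sqr_ge0.
Qed.

(* The number of sampled indices has mean [b] and variance at most [b], and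
   [b <= b^2] because the batch size is at least 1. *)
Lemma poisson_sampling_second_moment (R : realType) (dT : measure_display)
    (T : measurableType dT) (P : probability T R) (n : nat)
    (m : 'I_n -> T -> bool) (b : R) :
  (0 < n)%N -> 1 <= b ->
  (forall i, measurable_fun setT (m i)) ->
  (forall i, has_mean P (fun x => (m i x)%:R) (b / n%:R)) ->
  (forall i i', i != i' ->
     indep2 P (fun x => (m i x)%:R) (fun x => (m i' x)%:R)) ->
  exists2 v, has_mean P (fun x => (\sum_i (m i x)%:R) ^+ 2) v & v <= 2 * b ^+ 2.
Proof.
move=> n0 b1 mm mE iE; set p := b / n%:R.
have n0' : n%:R != 0 :> R by rewrite pnatr_eq0 -lt0n.
have mm' i : measurable_fun setT (fun x => (m i x)%:R : R).
  exact: measurable_bool_natr.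
exists (\sum_(i < n) \sum_(i' < n) (if i == i' then p else p * p)).
  have -> : (fun x => (\sum_i (m i x)%:R) ^+ 2 : R) =
      (fun x => \sum_(i < n) \sum_(i' < n) ((m i x)%:R * (m i' x)%:R)).
    by apply/funext => x; rewrite expr2 big_distrlr.
  apply: has_mean_sum => i; apply: has_mean_sum => i'.
  case: eqVneq => [<-|ii']; last exact: has_meanM (iE _ _ ii') (mE i) (mE i').
  by under eq_fun do rewrite -natrM mulnb andbb; exact: mE.
have b0 : 0 <= b by exact: le_trans b1.
(* In each row the [n - 1] off-diagonal terms are enlarged to [n], so the total is
   [n p + (n p)^2 = b + b^2]. *)
apply: (@le_trans _ _ (\sum_(i < n) (p + n%:R * (p * p)))).
  apply: ler_sum => i _; rewrite (bigD1 i)//= eqxx lerD2l.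
  apply: (@le_trans _ _ (\sum_(i' < n) (p * p))); last first.
    by rewrite sumr_const card_ord mulr_natl.
  rewrite [leRHS](bigD1 i)//= -[leLHS]add0r.
  apply: lerD; first by rewrite -expr2 sqr_ge0.
  by apply: ler_sum => i' /negbTE; rewrite eq_sym => ->.
rewrite sumr_const card_ord -[leLHS]mulr_natl /p.
have -> : n%:R * (b / n%:R + n%:R * (b / n%:R * (b / n%:R))) = b + b ^+ 2.
  by field.
nra.
Qed.

Section one_step.
Context (R : realType) (dT : measure_display) (T : measurableType dT).
Context (P : probability T R) (d n : nat) (b eta tau s : R).
Context (u : T -> 'rV[R]_d) (c : 'I_n -> T -> 'rV[R]_d).
Context (m : 'I_n -> T -> bool) (z : 'I_d -> T -> R).

Hypotheses (n0 : (0 < n)%N) (b1 : 1 <= b) (tau0 : 0 < tau) (eta0 : 0 <= eta).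
Hypotheses (mu : forall j, measurable_fun setT (fun x => u x 0 j)).
Hypotheses (mc : forall i j, measurable_fun setT (fun x => c i x 0 j)).
Hypotheses (c_tau : forall i x, enorm (c i x) <= tau).
Hypotheses (mm : forall i, measurable_fun setT (m i)).
Hypotheses (mz : forall j, measurable_fun setT (z j)).
Hypotheses (m_mean : forall i, has_mean P (fun x => (m i x)%:R) (b / n%:R)).
Hypotheses (mm_indep : forall i i', i != i' ->
  indep2 P (fun x => (m i x)%:R : R) (fun x => (m i' x)%:R : R)).
Hypotheses (um_indep : forall i,
  indep2 P (fun x => dotp (c i x) (u x)) (fun x => (m i x)%:R : R)).
Hypotheses (z_mean : forall j, has_mean P (z j) 0).
Hypotheses (z_var : forall j, exists2 v, has_mean P (fun x => z j x ^+ 2) v &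
  v <= s ^+ 2).

Let S x : 'rV[R]_d := \sum_(i < n | m i x) c i x.
(** The step before its noise is added: it depends on the current masks but is independent of the
    current noise, so its cross term with the noise has mean 0. *)
Let V x := u x - eta *: (b^-1 *: S x).
Let zrow x : 'rV[R]_d := \row_j z j x.
Let N x : R := \sum_(i < n) (m i x)%:R.

Hypotheses (Vz_indep : forall j, indep2 P (fun x => V x 0 j) (z j)).

Let SE x : S x = \sum_(i < n) (m i x)%:R *: c i x.
Proof.
by rewrite /S big_mkcond; apply: eq_bigr => i _; case: (m i x);
  rewrite ?scale1r ?scale0r.
Qed.

Let mS j : measurable_fun setT (fun x => S x 0 j).
Proof.
under eq_fun do rewrite SE summxE.
apply: measurable_sum => i; under eq_fun do rewrite mxE.
by apply: measurable_funM => //; exact: measurable_bool_natr.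
Qed.

Let mV j : measurable_fun setT (fun x => V x 0 j).
Proof.
under eq_fun do rewrite !mxE.
apply: measurable_funB => //; apply: measurable_funM => //.
exact: measurable_funM.
Qed.

Let enormS x : enorm (S x) <= tau * N x.
Proof.
rewrite SE; apply: le_trans (enorm_sum _ _ _ _ _) _.
rewrite mulr_sumr; apply: ler_sum => i _.
by rewrite enormZ normr_nat mulrC ler_wpM2r.
Qed.

(** The square is expanded twice, first around [V] and then around [u]. The linear term keeps the
    exact mean [g], since a mask has mean [b/n] and is independent of [dotp (c i x) (u x)]. The
    quadratic term is first bounded pointwise by [tau * N], so that only the sample size enters. *)
Lemma sgd_step_second_moment (a : R) :
  has_mean P (fun x => enorm (u x) ^+ 2) a ->
  let g := \int[P]_x (n%:R^-1 * \sum_(i < n) dotp (c i x) (u x)) in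
  P.-integrable setT
    (EFin \o (fun x => n%:R^-1 * \sum_(i < n) dotp (c i x) (u x))) /\
  exists2 a', has_mean P
      (fun x => enorm (u x - eta *: (b^-1 *: S x + zrow x)) ^+ 2) a' &
    a' <= a - 2 * eta * g + eta ^+ 2 * (2 * tau ^+ 2 + d%:R * s ^+ 2).
Proof.
move=> ua g; have b0 : 0 < b by exact: lt_le_trans b1.
have n0' : n%:R != 0 :> R by rewrite pnatr_eq0 -lt0n.
have mcu i : measurable_fun setT (fun x => dotp (c i x) (u x)).
  exact: measurable_dotp.
have u1 : has_mean P (fun x => 1 + enorm (u x) ^+ 2) (1 + a).
  by apply: has_meanD => //; exact: has_mean_cst.
(* Lets the second moment of [u] dominate every quantity that is linear in [u]. *)
have ule x : enorm (u x) <= 1 + enorm (u x) ^+ 2.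
  by have := enorm_ge0 _ _ (u x); nra.
have cui i : P.-integrable setT (EFin \o (fun x => dotp (c i x) (u x))).
  apply: (dominated_integrable _ _ _ _ _ _ _ _ (has_meanZ _ _ _ _ tau _ _ u1)) => //.
  move=> x; apply: le_trans (dotp_CS _ _ _ _) _.
  by apply: ler_pM; rewrite ?enorm_ge0.
have gm : has_mean P (fun x => n%:R^-1 * \sum_(i < n) dotp (c i x) (u x)) g.
  split=> //.
  exact: (has_meanZ _ _ _ _ n%:R^-1 _ _
    (has_mean_sum _ _ _ _ _ _ _ _ (fun i => has_mean_integrable _ _ _ _ _ (cui i)))).1.
split; first exact: gm.1.
have gE : g = n%:R^-1 * \sum_(i < n) \int[P]_x dotp (c i x) (u x).
  exact: (has_meanZ _ _ _ _ n%:R^-1 _ _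
    (has_mean_sum _ _ _ _ _ _ _ _ (fun i => has_mean_integrable _ _ _ _ _ (cui i)))).2.
have cross : has_mean P (fun x => b^-1 * \sum_(i < n) (dotp (c i x) (u x) * (m i x)%:R)) g.
  have -> : g = b^-1 * \sum_(i < n) (\int[P]_x dotp (c i x) (u x) * (b / n%:R)).
    by rewrite gE -mulr_suml; field; rewrite n0' gt_eqF.
  apply: has_meanZ; apply: has_mean_sum => i; apply: has_meanM => //.
  exact: measurable_bool_natr.
have [vN N2 vNle] := poisson_sampling_second_moment _ _ _ _ _ m b n0 b1 mm m_mean mm_indep.
have Vint j : P.-integrable setT (EFin \o (fun x => V x 0 j)).
  have h := has_meanD _ _ _ _ _ _ _ _ u1
    (has_mean_cst _ _ _ P (eta * (b^-1 * (tau * n%:R)))).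
  apply: (dominated_integrable _ _ _ _ _ _ _ (mV j) h) => x.
  apply: le_trans (coord_le_enorm _ _ _ _) _.
  apply: le_trans (enormD _ _ _ _) _; apply: lerD; first exact: ule.
  rewrite -scaleN1r !enormZ normrN1 mul1r ger0_norm//.
  have bi0 : 0 <= b^-1 by rewrite invr_ge0 ltW.
  rewrite ger0_norm// ler_wpM2l// ler_wpM2l//.
  apply: le_trans (enormS x) _; apply: ler_wpM2l; first exact: ltW.
  apply: (@le_trans _ _ (\sum_(i < n) 1)); last by rewrite sumr_const card_ord.
  by apply: ler_sum => i _; case: (m i x); rewrite ?ler01.
have Vz : has_mean P (fun x => dotp (V x) (zrow x)) 0.
  have -> : 0 = \sum_(j < d) (\int[P]_x (V x 0 j) * 0) :> R.
    by rewrite big1// => j _; rewrite mulr0.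
  apply: has_mean_sum => j.
  have -> : (fun x => V x 0 j * zrow x 0 j) = (fun x => V x 0 j * z j x).
    by apply/funext => x; rewrite [zrow x 0 j]mxE.
  exact: (has_meanM _ _ _ _ _ _ _ _ (mV j) (mz j) (Vz_indep j)
    (has_mean_integrable _ _ _ _ _ (Vint j)) (z_mean j)).
pose vz j := \int[P]_x (z j x ^+ 2).
have vzE j : has_mean P (fun x => z j x ^+ 2) (vz j).
  by have [v [h _] _] := z_var j.
have vzs j : vz j <= s ^+ 2.
  by have [v [_ <-] ?] := z_var j.
have zz : has_mean P (fun x => enorm (zrow x) ^+ 2) (\sum_(j < d) vz j).
  have -> : (fun x => enorm (zrow x) ^+ 2) = (fun x => \sum_(j < d) z j x ^+ 2).
    by apply/funext => x; rewrite sqr_enorm; apply: eq_bigr => j _; rewrite mxE.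
  exact: has_mean_sum.
(* A pointwise majorant of the next squared distance: each of its terms has a known mean, and it
   also dominates the square to make it integrable. *)
pose bound x := enorm (u x) ^+ 2
  - 2 * eta * (b^-1 * \sum_(i < n) (dotp (c i x) (u x) * (m i x)%:R))
  + (eta / b * tau) ^+ 2 * N x ^+ 2
  - 2 * eta * dotp (V x) (zrow x) + eta ^+ 2 * enorm (zrow x) ^+ 2.
have boundE : has_mean P bound (a - 2 * eta * g + (eta / b * tau) ^+ 2 * vN
    - 2 * eta * 0 + eta ^+ 2 * \sum_(j < d) vz j).
  apply: has_meanD; last exact: has_meanZ.
  apply: has_meanB; last exact: has_meanZ.
  apply: has_meanD; last exact: has_meanZ.
  by apply: has_meanB => //; exact: has_meanZ.
have le_bound x : enorm (u x - eta *: (b^-1 *: S x + zrow x)) ^+ 2 <= bound x.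
  have -> : u x - eta *: (b^-1 *: S x + zrow x) = V x - eta *: zrow x.
    by rewrite /V scalerDr opprD addrA.
  have := sqr_enormB _ _ eta (V x) (zrow x).
  have : enorm (V x) ^+ 2 = enorm (u x) ^+ 2 -
      2 * eta * (b^-1 * dotp (S x) (u x)) + (eta / b) ^+ 2 * enorm (S x) ^+ 2.
    rewrite /V scalerA sqr_enormB (dotpC _ _ (u x)); ring.
  have -> : dotp (S x) (u x) = \sum_(i < n) (dotp (c i x) (u x) * (m i x)%:R).
    rewrite SE dotp_suml; apply: eq_bigr => i _.
    by rewrite dotpZl mulrC.
  have : (eta / b) ^+ 2 * enorm (S x) ^+ 2 <= (eta / b * tau) ^+ 2 * N x ^+ 2.
    have -> : (eta / b * tau) ^+ 2 * N x ^+ 2 = (eta / b) ^+ 2 * (tau * N x) ^+ 2.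
      by ring.
    apply: ler_wpM2l; first exact: sqr_ge0.
    by rewrite ler_sqr ?nnegrE ?enorm_ge0// (le_trans (enorm_ge0 _ _ _) (enormS x)).
  rewrite /bound; lra.
have int' : P.-integrable setT
    (EFin \o (fun x => enorm (u x - eta *: (b^-1 *: S x + zrow x)) ^+ 2)).
  apply: (dominated_integrable _ _ _ _ _ _ _ _ boundE).
    apply: measurable_funX; apply: measurable_enorm => j.
    under eq_fun do rewrite !mxE.
    apply: measurable_funB => //; apply: measurable_funM => //.
    by apply: measurable_funD => //; exact: measurable_funM.
  by move=> x; rewrite ger0_norm ?sqr_ge0.
exists (\int[P]_x (enorm (u x - eta *: (b^-1 *: S x + zrow x)) ^+ 2)) => //.
apply: le_trans (has_mean_le _ _ _ _ _ _ _ _ (conj int' erefl) boundE le_bound) _.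
have h1 : (eta / b * tau) ^+ 2 * vN <= eta ^+ 2 * (2 * tau ^+ 2).
  apply: (@le_trans _ _ ((eta / b * tau) ^+ 2 * (2 * b ^+ 2))).
    by rewrite ler_wpM2l ?sqr_ge0.
  by rewrite le_eqVlt; apply/orP; left; apply/eqP; field; rewrite gt_eqF.
have h2 : eta ^+ 2 * \sum_(j < d) vz j <= eta ^+ 2 * (d%:R * s ^+ 2).
  rewrite ler_wpM2l ?sqr_ge0//; apply: (@le_trans _ _ (\sum_(j < d) s ^+ 2)).
    exact: ler_sum.
  by rewrite sumr_const card_ord mulr_natl.
lra.
Qed.
End one_step.

(** * DP-SGD iterates *)

(** Phrased on preimages because [T] already carries its own sigma-algebra. [gen_measurableE] moves
    to the type carrying the generated one, where the usual closure lemmas for [measurable_fun]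
    apply. *)
Definition gen_measurable {dT dU} {T : measurableType dT} {I : eqType}
    {U : measurableType dU} (F : I -> set (set T)) (L : set I) (Y : T -> U) :=
  forall B, measurable B -> <<s cylinders F L >> (Y @^-1` B).

Lemma gen_measurableE (dT dU : measure_display) (T : measurableType dT)
    (I : eqType) (U : measurableType dU) (F : I -> set (set T)) (L : set I)
    (Y : T -> U) :
  gen_measurable F L Y <->
  measurable_fun setT (Y : g_sigma_algebraType (cylinders F L) -> U).
Proof.
split => [gY _ B mB|mY B mB]; first by rewrite setTI; exact: gY.
by rewrite -[X in <<s _ >> X]setTI; exact: mY.
Qed.

Lemma sub_gen_measurable (dT dU : measure_display) (T : measurableType dT)
    (I : eqType) (U : measurableType dU) (F : I -> set (set T)) (L L' : set I)
    (Y : T -> U) :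
  L `<=` L' -> gen_measurable F L Y -> gen_measurable F L' Y.
Proof.
move=> LL' gY B mB; apply: sub_sigma_algebra2 (gY B mB).
move=> _ [J [A [uJ LA ->]]]; exists J, A; split => // j /LA [Lj Fj].
by split => //; exact: LL'.
Qed.

Lemma gen_measurable_preimage (dT dU : measure_display) (T : measurableType dT)
    (I : eqType) (U : measurableType dU) (F : I -> set (set T)) (L : set I)
    (Y : T -> U) (i : I) :
  L i -> preimage_sets Y `<=` F i -> gen_measurable F L Y.
Proof.
move=> Li YF B mB; apply: sub_sigma_algebra.
by apply: (sub_cylinders _ _ F L i Li); apply: YF; exists B.
Qed.

Lemma gen_measurable_fun (dT dU : measure_display) (T : measurableType dT)
    (I : eqType) (U : measurableType dU) (F : I -> set (set T)) (L : set I)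
    (Y : T -> U) :
  (forall i, F i `<=` measurable) -> gen_measurable F L Y ->
  measurable_fun setT Y.
Proof.
move=> mF gY _ B mB; rewrite setTI; have := gY B mB; move: (Y @^-1` B).
apply: smallest_sub; first exact: sigma_algebra_measurable.
exact: cylinders_measurable.
Qed.

Lemma gen_measurable_indep2 (R : realType) (dT : measure_display)
    (T : measurableType dT) (P : probability T R) (I : eqType)
    (F : I -> set (set T)) (L1 L2 : set I) (Y Z : T -> R) :
  (forall i, F i `<=` measurable) -> (forall i, F i setT) ->
  (forall i, setI_closed (F i)) ->
  mutually_independent P F -> L1 `&` L2 = set0 ->
  gen_measurable F L1 Y -> gen_measurable F L2 Z -> indep2 P Y Z.
Proof.
move=> mF FT FI iF L12 gY gZ A B mA mB.
exact: (indep_sigma _ _ _ _ _ _ _ _ mF FT FI iF L12 _ _ (gY A mA) (gZ B mB)).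
Qed.

Lemma preimage_setsT (dT dU : measure_display) (T : measurableType dT)
    (U : measurableType dU) (X : T -> U) : preimage_sets X setT.
Proof. by exists setT. Qed.

Lemma preimage_sets_setI (dT dU : measure_display) (T : measurableType dT)
    (U : measurableType dU) (X : T -> U) : setI_closed (preimage_sets X).
Proof.
by move=> _ _ [A mA <-] [B mB <-]; exists (A `&` B) => //; exact: measurableI.
Qed.

Lemma preimage_sets_measurable (dT dU : measure_display)
    (T : measurableType dT) (U : measurableType dU) (X : T -> U) :
  measurable_fun setT X -> preimage_sets X `<=` measurable.
Proof.
by move=> mX _ [B mB <-]; rewrite -[X in measurable X]setTI; exact: mX.
Qed.

Definition noise_index n d : eqType := ((nat * 'I_n) + (nat * 'I_d) + unit)%type.

(** Leaving out the index of [That] is what makes the iterates independent of the output time. *)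
Definition past {n d : nat} (t : nat) : set (noise_index n d) :=
  [set i | match i with
           | inl (inl p) => (p.1 < t)%N
           | inl (inr p) => (p.1 < t)%N
           | inr _ => False
           end].

Definition masks {n d : nat} (t : nat) : set (noise_index n d) :=
  [set i | exists j, i = inl (inl (t, j))].

Section dpsgd_random.
Context (R : realType) (dT : measure_display) (T : measurableType dT).
Context (P : probability T R) (d n : nat) (b eta tau : R).
Context (fi : 'I_n -> 'rV[R]_d -> R) (w0 : 'rV[R]_d).
Context (M : nat -> 'I_n -> T -> bool) (Zeta : nat -> 'I_d -> T -> R).
Context (That : T -> nat).
Hypotheses (dfi : forall i w, differentiable (fi i) w).
Hypotheses (mM : forall t i, measurable_fun setT (M t i)).
Hypotheses (mZeta : forall t j, measurable_fun setT (Zeta t j)).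
Hypotheses (mThat : measurable_fun setT That).

Let F : noise_index n d -> set (set T) := alg_family M Zeta That.
Let w t := dpsgd fi b eta tau M Zeta w0 t.

Lemma alg_familyT i : F i setT.
Proof. by move: i => [[p|p]|p]; exact: preimage_setsT. Qed.

Lemma alg_family_setI i : setI_closed (F i).
Proof. by move: i => [[p|p]|p]; exact: preimage_sets_setI. Qed.

Lemma alg_family_measurable i : F i `<=` measurable.
Proof. by move: i => [[p|p]|p]; exact: preimage_sets_measurable. Qed.

Lemma gen_measurable_mask (L : set (noise_index n d)) t i :
  L (inl (inl (t, i))) -> gen_measurable F L (fun x => (M t i x)%:R : R).
Proof.
move=> Li; apply/gen_measurableE; apply: measurable_bool_natr.
apply/gen_measurableE.
exact: (gen_measurable_preimage _ _ _ _ _ _ _ _ (inl (inl (t, i)))).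
Qed.

Lemma gen_measurable_noise (L : set (noise_index n d)) t j :
  L (inl (inr (t, j))) -> gen_measurable F L (Zeta t j).
Proof.
move=> Li.
exact: (gen_measurable_preimage _ _ _ _ _ _ _ _ (inl (inr (t, j)))).
Qed.

Lemma gen_measurable_clip_grad (L : set (noise_index n d)) (W : T -> 'rV[R]_d) :
  (forall j, gen_measurable F L (fun x => W x 0 j)) ->
  forall i j, gen_measurable F L (fun x => clip (grad (fi i) (W x)) tau 0 j).
Proof.
move=> gW i j; apply/gen_measurableE.
apply: (measurable_clip _ _ (g_sigma_algebraType (cylinders F L)) _
  (fun x => grad (fi i) (W x))) => l.
apply: (measurable_grad _ _ (g_sigma_algebraType (cylinders F L))) => //.
by move=> l'; apply/gen_measurableE; exact: gW.
Qed.

(** The base point [u] is kept apart from [w t], since both [w t] and [w t - wstar] are needed in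
    its place. *)
Let V (u : T -> 'rV[R]_d) t x : 'rV[R]_d :=
  u x - eta *: (b^-1 *: \sum_(i < n | M t i x) clip (grad (fi i) (w t x)) tau).

Lemma gen_measurable_half_step (L : set (noise_index n d)) t
    (u : T -> 'rV[R]_d) :
  (forall i, L (inl (inl (t, i)))) ->
  (forall j, gen_measurable F L (fun x => u x 0 j)) ->
  (forall j, gen_measurable F L (fun x => w t x 0 j)) ->
  forall j, gen_measurable F L (fun x => V u t x 0 j).
Proof.
move=> Lt gu gw j.
have -> : (fun x => V u t x 0 j) = (fun x => u x 0 j - eta * (b^-1 *
    \sum_(i < n) ((M t i x)%:R * clip (grad (fi i) (w t x)) tau 0 j))).
  apply/funext => x; rewrite !mxE summxE; congr (_ - _ * (_ * _)).
  rewrite big_mkcond; apply: eq_bigr => i _.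
  by case: (M t i x); rewrite ?mul1r ?mul0r.
apply/gen_measurableE; apply: measurable_funB; first exact/gen_measurableE.
apply: measurable_funM => //; apply: measurable_funM => //.
apply: measurable_sum => i; apply: measurable_funM; apply/gen_measurableE.
  exact: gen_measurable_mask.
exact: gen_measurable_clip_grad.
Qed.

Lemma gen_measurable_dpsgd t :
  forall j, gen_measurable F (past t) (fun x => w t x 0 j).
Proof.
elim: t => [|t IH] j; first exact/gen_measurableE/measurable_cst.
have IH' j' : gen_measurable F (past t.+1) (fun x => w t x 0 j').
  apply: sub_gen_measurable (IH j') => -[[p|p]|p] //=; exact: ltnW.
have -> : (fun x => w t.+1 x 0 j) = (fun x => V (w t) t x 0 j - eta * Zeta t j x).
  apply/funext => x.
  by rewrite /w /= -/(w t x) scalerDr opprD addrA !mxE.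
apply/gen_measurableE; apply: measurable_funB.
  by apply/gen_measurableE; apply: gen_measurable_half_step => // i /=.
apply: measurable_funM => //; apply/gen_measurableE.
exact: (gen_measurable_noise _ t j (ltnSn t)).
Qed.

Lemma measurable_dpsgd t j : measurable_fun setT (fun x => w t x 0 j).
Proof.
apply: gen_measurable_fun (gen_measurable_dpsgd t j).
exact: alg_family_measurable.
Qed.

Hypotheses (iF : mutually_independent P (alg_family M Zeta That)).

Let gen_indep2 (L1 L2 : set (noise_index n d)) (Y Z : T -> R) :
  L1 `&` L2 = set0 -> gen_measurable F L1 Y -> gen_measurable F L2 Z ->
  indep2 P Y Z.
Proof.
exact: (gen_measurable_indep2 _ _ _ _ _ F _ _ _ _ alg_family_measurable
  alg_familyT alg_family_setI iF).
Qed.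

Context (s : R) (wstar : 'rV[R]_d).
Hypotheses (n0 : (0 < n)%N) (b1 : 1 <= b) (tau0 : 0 < tau) (eta0 : 0 <= eta).
Hypotheses (s0 : 0 < s).
Hypotheses (Mlaw : forall t i, P (M t i @^-1` [set true]) = (b / n%:R)%:E).
Hypotheses (Zlaw : forall t j (B : set R), measurable B ->
  P (Zeta t j @^-1` B) = normal_prob 0 s B).

Let descent t x : R := n%:R^-1 *
  \sum_(i < n) dotp (clip (grad (fi i) (w t x)) tau) (w t x - wstar).

Lemma dpsgd_step t (a : R) :
  has_mean P (fun x => enorm (w t x - wstar) ^+ 2) a ->
  P.-integrable setT (EFin \o descent t) /\
  exists2 a', has_mean P (fun x => enorm (w t.+1 x - wstar) ^+ 2) a' &
    a' <= a - 2 * eta * (\int[P]_x descent t x)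
          + eta ^+ 2 * (2 * tau ^+ 2 + d%:R * s ^+ 2).
Proof.
move=> wa.
have gwt := gen_measurable_dpsgd t.
pose u x := w t x - wstar.
have gu j : gen_measurable F (past t) (fun x => u x 0 j).
  apply/gen_measurableE; under eq_fun do rewrite !mxE.
  by apply: measurable_funB => //; exact/gen_measurableE.
have gc := gen_measurable_clip_grad _ _ gwt.
have mgen L (Y : T -> R) : gen_measurable F L Y -> measurable_fun setT Y.
  exact: (gen_measurable_fun _ _ _ _ _ _ _ _ alg_family_measurable).
have sub1 : @past n d t `<=` past t `|` masks t by exact: subsetUl.
have := sgd_step_second_moment R dT T P d n b eta tau s u
  (fun i x => clip (grad (fi i) (w t x)) tau) (M t) (Zeta t).
move=> /(_ n0 b1 tau0 eta0) /(_ _ _ _ _ _ _ _ _ _ _ _ _ wa) [].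
- by move=> j; exact: mgen (gu j).
- by move=> i j; exact: mgen (gc i j).
- by move=> i x; exact: enorm_clip.
- by [].
- by [].
- by move=> i; exact: has_mean_bool.
- move=> i i' ii'.
  apply: (gen_indep2 [set inl (inl (t, i))] [set inl (inl (t, i'))]).
  + apply/seteqP; split => // x /= [->] [] /eqP; rewrite (negbTE ii')//.
  + exact: gen_measurable_mask.
  + exact: gen_measurable_mask.
- move=> i; apply: (gen_indep2 (past t) [set inl (inl (t, i))]).
  + by apply/seteqP; split => // x /= [+ xE]; rewrite xE /= ltnn.
  + apply/gen_measurableE; apply: measurable_dotp => j; apply/gen_measurableE.
      exact: gc.
    exact: gu.
  + exact: gen_measurable_mask.
- by move=> j; have [iz z0 _ _] := normal_law_moments _ _ _ _ _ _ s0 (mZeta t j) (Zlaw t j); split.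
- move=> j; have [_ _ iz zs] := normal_law_moments _ _ _ _ _ _ s0 (mZeta t j) (Zlaw t j).
  by eexists; [split; [exact: iz|reflexivity]|].
(* The noise-free half step also uses the masks of time [t], so the past alone does not determine
   it; the noise of time [t] lies outside both index sets. *)
- move=> j; apply: (gen_indep2 (past t `|` masks t) [set inl (inr (t, j))]).
  + apply/seteqP; split => // x /= [+ xE]; rewrite xE /= => -[|[]//].
    by rewrite ltnn.
  + apply: (gen_measurable_half_step _ t u).
    * by move=> i; right; exists i.
    * by move=> j'; exact: sub_gen_measurable sub1 (gu j').
    * by move=> j'; exact: sub_gen_measurable sub1 (gwt j').
  + exact: gen_measurable_noise.
move=> id [a' a'E a'le]; split; first exact: id.
exists a' => //.
have -> : (fun x => enorm (w t.+1 x - wstar) ^+ 2) = (fun x =>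
   enorm (u x - eta *: (b^-1 *: (\sum_(i < n | M t i x)
      clip (grad (fi i) (w t x)) tau) + \row_j Zeta t j x)) ^+ 2).
  apply/funext => x; congr (enorm _ ^+ 2).
  by rewrite /w /= -/(w t x) /u addrAC.
exact: a'E.
Qed.

(** Existence of the second moment belongs to the induction because the integrability of [descent t]
    is deduced from it. The nonnegative final distance is dropped at the end. *)
Lemma dpsgd_descent_sum (K : nat) :
  (forall t, P.-integrable setT (EFin \o descent t)) /\
  2 * eta * \sum_(t < K) \int[P]_x descent t x <=
  enorm (w0 - wstar) ^+ 2 + K%:R * (eta ^+ 2 * (2 * tau ^+ 2 + d%:R * s ^+ 2)).
Proof.
have fin t : exists2 a, has_mean P (fun x => enorm (w t x - wstar) ^+ 2) a &
    a <= enorm (w0 - wstar) ^+ 2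
       - 2 * eta * \sum_(t' < t) \int[P]_x descent t' x
       + t%:R * (eta ^+ 2 * (2 * tau ^+ 2 + d%:R * s ^+ 2)).
  elim: t => [|t [a ha ale]].
    exists (enorm (w0 - wstar) ^+ 2); first exact: (has_mean_cst _ _ _ P (enorm (w0 - wstar) ^+ 2)).
    by rewrite big_ord0 mulr0 mul0r subr0 addr0.
  have [_ [a' ha' a'le]] := dpsgd_step t a ha.
  exists a' => //; apply: (le_trans a'le).
  rewrite big_ord_recr/= -natr1 mulrDr mulrDl mul1r; lra.
split.
  by move=> t; have [a ha _] := fin t; have [] := dpsgd_step t a ha.
have [a [ia aE] ale] := fin K.
have : 0 <= a by rewrite -aE; apply: Rintegral_ge0 => x _; rewrite sqr_ge0.
lra.
Qed.

Lemma indep2_dpsgd_That (h : 'rV[R]_d -> R) t : continuous h ->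
  indep2 P (fun x => h (w t x)) (fun x => (That x == t)%:R).
Proof.
move=> ch; apply: (gen_indep2 (past t) [set inr tt]).
- by apply/seteqP; split => // x /= [+ xE]; rewrite xE.
- apply/gen_measurableE.
  apply: (measurable_continuous_rV _ _ (g_sigma_algebraType (cylinders F (past t)))) => //.
  by move=> j; apply/gen_measurableE; exact: gen_measurable_dpsgd.
- have gT : gen_measurable F [set inr tt] That.
    exact: (gen_measurable_preimage _ _ _ _ _ _ _ _ (inr tt)).
  move=> B mB; have := gT ((fun t' => (t' == t)%:R) @^-1` B); exact.
Qed.

Lemma measurable_dpsgd_That (h : 'rV[R]_d -> R) : continuous h ->
  measurable_fun setT (fun x => h (w (That x) x)).
Proof.
move=> ch.
apply: (measurable_fun_countable _ _ _ _ _ That (fun t x => h (w t x))).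
  by move=> t; rewrite -[X in measurable X]setTI; exact: mThat.
move=> t; apply: measurable_continuous_rV => //.
by move=> j; exact: measurable_dpsgd.
Qed.

(** Since [That] is uniform and independent of each iterate, the mean of [h] at the output is the
    average over [t < K] of its means along the path. Hypothesis [hB] gives both the integrability
    of each [h (w t)] and the final bound. *)
Lemma dpsgd_output_mean (h : 'rV[R]_d -> R) (B : R) (K : nat) :
  0 < eta -> (0 < K)%N ->
  (forall t, P (That @^-1` [set t]) = (if (t < K)%N then K%:R^-1 else 0)%:E) ->
  continuous h -> (forall v, 0 <= h v) ->
  (forall t x, h (w t x) <= 2 * descent t x + B) ->
  exists2 v, has_mean P (fun x => h (w (That x) x)) v &
    v <= (enorm (w0 - wstar) ^+ 2
          + K%:R * (eta ^+ 2 * (2 * tau ^+ 2 + d%:R * s ^+ 2))) / (K%:R * eta) + B.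
Proof.
move=> eta_gt0 K0 Tlaw ch h0 hB.
have [idesc desc_le] := dpsgd_descent_sum K.
have K0' : 0 < K%:R :> R by rewrite ltr0n.
have mhw t : measurable_fun setT (fun x => h (w t x)).
  by apply: measurable_continuous_rV => // j; exact: measurable_dpsgd.
have bound t := has_meanD _ _ _ _ _ _ _ _
  (has_meanZ _ _ _ _ 2 _ _ (has_mean_integrable _ _ _ _ _ (idesc t)))
  (has_mean_cst _ _ _ P B).
have ih t : P.-integrable setT (EFin \o (fun x => h (w t x))).
  apply: (dominated_integrable _ _ _ _ _ _ _ (mhw t) (bound t)) => x.
  by rewrite ger0_norm.
have hm t := has_mean_integrable _ _ _ _ _ (ih t).
have mT t : measurable_fun setT (fun x => That x == t).
  by apply: measurable_fun_eqn => //; exact: measurable_cst.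
have Tm (t : 'I_K) : has_mean P (fun x => (That x == t)%:R) (K%:R^-1 : R).
  apply: has_mean_bool => //.
  have -> : (fun x => That x == t) @^-1` [set true] = That @^-1` [set nat_of_ord t].
    by apply/seteqP; split => x /= /eqP.
  by rewrite Tlaw ltn_ord.
have sum_mean : has_mean P (fun x => \sum_(t < K) (h (w t x) * (That x == t)%:R))
    (\sum_(t < K) (\int[P]_x h (w t x) * K%:R^-1)).
  apply: has_mean_sum => t.
  apply: (has_meanM _ _ _ _ _ _ _ _ (mhw t) _ _ (hm t) (Tm t)).
    exact: measurable_bool_natr.
  exact: indep2_dpsgd_That.
(* The law of [That] allows values [>= K] on a null set, so the output splits over [t < K] only
   almost everywhere. *)
have T_lt : {ae P, forall x, (That x < K)%N}.
  have : P.-negligible (\bigcup_t (That @^-1` [set (t + K)%N])).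
    apply: negligible_bigcup => t; apply/negligibleP.
      by rewrite -[X in measurable X]setTI; exact: mThat.
    by rewrite [LHS]Tlaw ltnNge leq_addl.
  apply: negligibleS => x /= /negP; rewrite -leqNgt => KT.
  by exists (That x - K)%N => //=; rewrite subnK.
have out_int : (\int[P]_x (h (w (That x) x))%:E =
    \int[P]_x (\sum_(t < K) (h (w t x) * (That x == t)%:R))%:E)%E.
  apply: ge0_ae_eq_integral => //.
  - exact/measurable_EFinP/measurable_dpsgd_That.
  - exact: measurable_int sum_mean.1.
  - by move=> x _; rewrite lee_fin.
  - by move=> x _; rewrite lee_fin sumr_ge0// => t _; rewrite mulr_ge0.
  apply: filterS T_lt => x /= TK _; congr EFin.
  rewrite (bigD1 (Ordinal TK))//= eqxx mulr1 big1 ?addr0// => t.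
  by rewrite -val_eqE /= eq_sym => /negbTE ->; rewrite mulr0.
have out_mean : has_mean P (fun x => h (w (That x) x))
    (\sum_(t < K) (\int[P]_x h (w t x) * K%:R^-1)).
  split; last by rewrite /Rintegral out_int; exact: sum_mean.2.
  apply/integrableP; split; first exact/measurable_EFinP/measurable_dpsgd_That.
  under eq_integral do rewrite /= ger0_norm//.
  rewrite out_int.
  have := integrable_fin_num measurableT sum_mean.1.
  by rewrite /= fin_numE ltey => /andP[].
exists (\sum_(t < K) (\int[P]_x h (w t x) * K%:R^-1)) => //.
have hle t : \int[P]_x h (w t x) <= 2 * \int[P]_x descent t x + B.
  exact: has_mean_le (hm t) (bound t) (hB t).
apply: (@le_trans _ _ (K%:R^-1 * (2 * \sum_(t < K) \int[P]_x descent t x) + B)).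
  rewrite -mulr_suml mulrC.
  have -> : K%:R^-1 * (2 * \sum_(t < K) \int[P]_x descent t x) + B =
    K%:R^-1 * \sum_(t < K) (2 * \int[P]_x descent t x + B).
    rewrite big_split/= sumr_const card_ord -mulr_sumr -[B *+ K]mulr_natl.
    by field; rewrite gt_eqF.
  by apply: ler_wpM2l; [rewrite invr_ge0|exact: ler_sum].
rewrite lerD2r ler_pdivlMr ?mulr_gt0//.
have -> : K%:R^-1 * (2 * \sum_(t < K) \int[P]_x descent t x) * (K%:R * eta) =
  2 * eta * \sum_(t < K) \int[P]_x descent t x.
  by field; rewrite gt_eqF.
exact: desc_le.
Qed.
End dpsgd_random.

(** * The dataset event and the final rates *)

(** The sum of the [g (Zs i om)] has mean at most [n m], so Markov at level [4 n m] costs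
    probability 1/4. Removing one more null set makes [good] hold at every sample on the whole
    event. *)
Lemma empirical_moment_event (R : realType) (dX : measure_display)
    (X : measurableType dX) (D : probability X R) (n : nat) (g : X -> R)
    (m : R) (good : X -> Prop) (d0 : measure_display)
    (Om0 : measurableType d0) (P0 : probability Om0 R)
    (Zs : 'I_n -> Om0 -> X) :
  (0 < n)%N -> 0 < m -> measurable_fun setT g -> (forall x, 0 <= g x) ->
  (\int[D]_x (g x)%:E <= m%:E)%E ->
  {ae D, forall x, good x} ->
  (forall i, measurable_fun setT (Zs i)) ->
  (forall i (B : set X), measurable B -> P0 (Zs i @^-1` B) = D B) ->
  exists A : set Om0, [/\ measurable A, ((3 / 4 : R)%:E <= P0 A)%E &
    forall om, A om -> (forall i, good (Zs i om)) /\
      n%:R^-1 * \sum_(i < n) g (Zs i om) <= 4 * m].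
Proof.
move=> n0 m0 mg g0 gm aegood mZ ZD.
have n0' : 0 < n%:R :> R by rewrite ltr0n.
have c0 : 0 < 4 * n%:R * m by rewrite !mulr_gt0.
pose S om := \sum_(i < n) g (Zs i om).
have mgZ i : measurable_fun setT (fun om => g (Zs i om)).
  exact: measurableT_comp.
have mS : measurable_fun setT S by exact: measurable_sum.
have S0 om : 0 <= S om by exact: sumr_ge0.
have intS : (\int[P0]_om (S om)%:E <= (n%:R * m)%:E)%E.
  under eq_integral do rewrite /S -sumEFin.
  rewrite ge0_integral_sum//; last 2 first.
  - by move=> i; exact/measurable_EFinP.
  - by move=> i om _; rewrite lee_fin.
  apply: (@le_trans _ _ (\sum_(i < n) m%:E)%E); last first.
    by rewrite sumEFin sumr_const card_ord mulr_natl.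
  apply: lee_sum => i _; apply: le_trans gm.
  rewrite [leRHS](eq_measure_integral (pushforward P0 (Zs i))); last first.
    by move=> A mA _; exact: esym (ZD i A mA).
  rewrite ge0_integral_pushforward//; first exact/measurable_EFinP.
  by move=> x _; rewrite lee_fin.
pose B := [set om | 4 * n%:R * m <= S om].
have mB : measurable B.
  rewrite -[X in measurable X]setTI; apply: measurable_fun_le => //.
have PB : (P0 B <= (1 / 4)%:E)%E.
  have h : ((4 * n%:R * m)%:E * P0 B <= (n%:R * m)%:E)%E.
    apply: le_trans intS; rewrite -integral_cst//.
    apply: (@le_trans _ _ (\int[P0]_(om in B) (S om)%:E)%E).
      apply: ge0_le_integral => //.
      - by move=> om _; rewrite lee_fin ltW.
      - exact/measurable_EFinP/measurable_funTS.
    apply: ge0_subset_integral => //.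
    - exact/measurable_EFinP.
    - by move=> om _; rewrite lee_fin.
  have fP : P0 B \is a fin_num by rewrite fin_num_measure.
  move: h; rewrite -(fineK fP) -EFinM !lee_fin => h.
  rewrite ler_pdivlMr// -(ler_pM2r (_ : 0 < n%:R * m)) ?mulr_gt0//.
  by rewrite mul1r; apply: le_trans h; rewrite le_eqVlt; apply/orP; left;
    apply/eqP; ring.
have aeg : {ae P0, forall om, forall i, good (Zs i om)}.
  apply: filter_forall => i; have [N [mN N0 gN]] := aegood.
  exists (Zs i @^-1` N); split.
  - by rewrite -[X in measurable X]setTI; exact: mZ.
  - by rewrite [LHS]ZD.
  - by move=> om /= h; exact: gN.
(* [good] may define a non-measurable set, so a measurable null set containing its failures is
   removed instead. *)
have [N [mN N0 gN]] := aeg.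
exists (~` (B `|` N)); split.
- by apply: measurableC; exact: measurableU.
- have mBN : measurable (B `|` N) by exact: measurableU.
  have h : (P0 (B `|` N) <= (1 / 4)%:E)%E.
    apply: le_trans (measureU2 _ mB mN) _.
    by rewrite [X in (_ + X)%E]N0 adde0.
  rewrite probability_setC//.
  have fP : P0 (B `|` N) \is a fin_num by rewrite fin_num_measure.
  move: h; rewrite -(fineK fP) -EFinB !lee_fin; lra.
- move=> om /not_orP[nB nN]; split.
    by apply: contrapT => h; apply: nN; exact: gN.
  move: nB => /negP; rewrite -ltNge => /ltW h.
  rewrite mulrC ler_pdivrMr//; apply: le_trans h _.
  by rewrite le_eqVlt; apply/orP; left; apply/eqP; ring.
Qed.

(** This is where the shape of [dp_phi] comes from: the total noise variance becomes
    [T phi^2 tau^2], directly comparable with the sampling term [2 tau^2]. *)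
Lemma dp_noise_variance (R : realType) (d n : nat) (nu eps delta T tau : R) :
  (0 < n)%N -> 0 < nu -> 0 < eps -> 0 < delta -> delta < 1 ->
  d%:R * (nu * T * ln (delta^-1) * tau ^+ 2 / (n%:R ^+ 2 * eps ^+ 2)) =
  T * (dp_phi nu d n eps delta) ^+ 2 * tau ^+ 2.
Proof.
move=> n0 nu0 eps0 delta0 delta1.
have n0' : n%:R != 0 :> R by rewrite pnatr_eq0 -lt0n.
rewrite /dp_phi exprMn sqr_sqrtr; last first.
  rewrite mulr_ge0// ?mulr_ge0// ?ltW//.
  by rewrite ln_gt0// invf_gt1.
by field; rewrite n0' gt_eqF.
Qed.

Lemma continuous_mean (R : realType) (d n : nat) (fi : 'I_n -> 'rV[R]_d -> R) :
  (forall i, continuous (fi i)) ->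
  continuous (fun w => n%:R^-1 * \sum_(i < n) fi i w).
Proof.
move=> cfi.
have csum : continuous (fun w => \sum_(i < n) fi i w).
  by apply: continuous_big => // ?; exact: add_continuous.
by move=> w; exact: (continuous_comp (csum w) (@mulrl_continuous _ _ _)).
Qed.

(** The exponent in [tau] balances two errors: by this lemma and the next, the clipping bias
    [tau^(1-k) G^k] and the optimization error [tau r^(1/2)] are both equal to [G r^((1-1/k)/2)]. *)
Lemma clip_norm_pow (R : realType) (r G k : R) : 0 < r -> 0 < G -> 1 < k ->
  (G * r `^ (- (2 * k)^-1)) `^ (1 - k) * G `^ k = G * r `^ (2^-1 * (1 - k^-1)).
Proof.
move=> r0 G0 k1; have k0 : k != 0 by rewrite gt_eqF// (lt_trans _ k1).
rewrite powRM ?powR_ge0 ?ltW// -powRrM.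
have -> : - (2 * k)^-1 * (1 - k) = 2^-1 * (1 - k^-1) by field.
rewrite mulrAC -powRD; last by apply/implyP => _; rewrite gt_eqF.
by rewrite subrK powRr1 ?ltW.
Qed.

Lemma clip_norm_sqrt (R : realType) (r G k : R) : 0 < r -> 0 < G -> 1 < k ->
  G * r `^ (- (2 * k)^-1) * r `^ (2^-1) = G * r `^ (2^-1 * (1 - k^-1)).
Proof.
move=> r0 G0 k1; have k0 : k != 0 by rewrite gt_eqF// (lt_trans _ k1).
rewrite -mulrA -powRD; last by apply/implyP => _; rewrite gt_eqF.
by congr (_ * _ `^ _); field.
Qed.

(** Here [r] is the square root of [1/T + phi^2] and [p] is [phi^2]. The step size turns the initial
    distance term into exactly [N/C * (tau * r)]; the variance term costs [2 C] because
    [2 + T p <= 2 T r^2]. *)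
Lemma step_size_balance (R : realType) (N C T tau r p eta : R) :
  0 < C -> 0 < T -> 0 < tau -> 0 < r -> 0 <= p -> r ^+ 2 = T^-1 + p ->
  eta = C / (T * tau) * r^-1 ->
  (N + T * (eta ^+ 2 * (2 * tau ^+ 2 + T * p * tau ^+ 2))) / (T * eta) <=
  (N / C + 2 * C) * (tau * r).
Proof.
move=> C0 T0 tau0 r0 p0 r2 etaE.
have -> : (N + T * (eta ^+ 2 * (2 * tau ^+ 2 + T * p * tau ^+ 2))) / (T * eta) =
  N / C * (tau * r) + C * tau / (T * r) * (2 + T * p).
  by rewrite etaE; field; rewrite !gt_eqF.
rewrite mulrDl lerD2l.
have -> : 2 * C * (tau * r) = C * tau / (T * r) * (2 * (T * r ^+ 2)).
  by field; rewrite !gt_eqF.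
apply: ler_wpM2l; first by rewrite divr_ge0// ltW// mulr_gt0.
rewrite r2 mulrDr divff ?gt_eqF//.
have : 0 <= T * p by rewrite mulr_ge0// ltW.
lra.
Qed.

Lemma dp_phi_gt0 (R : realType) (nu eps delta : R) (d n : nat) :
  0 < nu -> 0 < eps -> 0 < delta -> delta < 1 -> (0 < n)%N -> (0 < d)%N ->
  0 < dp_phi nu d n eps delta.
Proof.
move=> nu0 eps0 delta0 delta1 n0 d0; rewrite /dp_phi divr_gt0 ?mulr_gt0 ?ltr0n//.
by rewrite sqrtr_gt0 !mulr_gt0 ?ltr0n// ln_gt0// invf_gt1.
Qed.

(** The factor is really [2^((1-1/k)/2)], rounded up to 2. *)
Lemma privacy_rate_le (R : realType) (phi T k : R) :
  0 < phi -> 0 < T -> phi ^- 2 <= T -> 1 < k ->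
  (T^-1 + phi ^+ 2) `^ (2^-1 * (1 - k^-1)) <= 2 * phi `^ (1 - k^-1).
Proof.
move=> phi0 T0 hT k1; have k0 : 0 < k by exact: lt_trans k1.
set q := 1 - k^-1.
have q0 : 0 <= q by rewrite subr_ge0 invf_le1// ltW.
have q1 : q <= 1 by rewrite gerBl invr_ge0 ltW.
have TV : T^-1 <= phi ^+ 2.
  by rewrite -[leRHS]invrK lef_pV2 ?posrE ?invr_gt0 ?exprn_gt0.
apply: (@le_trans _ _ ((2 * phi ^+ 2) `^ (2^-1 * q))).
  apply: ge0_ler_powR.
  - by rewrite mulr_ge0.
  - by rewrite nnegrE addr_ge0 ?sqr_ge0// invr_ge0 ltW.
  - by rewrite nnegrE mulr_ge0 ?sqr_ge0.
  - by lra.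
rewrite powRM ?sqr_ge0// -(powR_mulrn 2 (ltW phi0)) -[X in _ * X]powRrM.
rewrite mulrA divff ?mul1r// ler_wpM2r ?powR_ge0//.
rewrite -[leRHS](@powRr1 _ 2)//; apply: ler_powR; first by rewrite ler1n.
lra.
Qed.

Theorem mainTheorem4
  (R : realType)
  (* data distribution D on the sample space X, loss, gradient envelope *)
  (dX : measure_display) (X : measurableType dX) (D : probability X R)
  (d n : nat) (loss : 'rV[R]_d -> X -> R) (Gf : X -> R) (k G : R)
  (Hdiff : forall (x : X) w, differentiable (fun v : 'rV[R]_d => loss v x) w)
  (HGf0 : forall x, 0 <= Gf x)
  (HGfm : measurable_fun setT Gf)
  (HGb : {ae D, forall x, forall w : 'rV[R]_d,
            enorm (grad (fun v => loss v x) w) <= Gf x})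
  (Hk : 1 < k) (HG : 0 < G)
  (Hmom : ('E_D[fun x => (Gf x `^ k)%R] `^ k^-1 <= G%:E)%E)
  (* privacy parameters *)
  (nu eps delta : R) (Hnu : 0 < nu) (Heps : 0 < eps)
  (Hdelta0 : 0 < delta) (Hdelta1 : delta < 1) (Hn : (0 < n)%N)
  (* the i.i.d. dataset Z = (Zs i)_i on a probability space (Om0, P0) *)
  (d0 : measure_display) (Om0 : measurableType d0) (P0 : probability Om0 R)
  (Zs : 'I_n -> Om0 -> X)
  (HZm : forall i, measurable_fun setT (Zs i))
  (HZd : forall i (B : set X), measurable B -> P0 (Zs i @^-1` B) = D B)
  (HZi : mutually_independent P0 (fun i => preimage_sets (Zs i)))
  (* algorithm parameters *)
  (C : R) (HC : 0 < C) (T : nat) (HT0 : (0 < T)%N)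
  (HT : (dp_phi nu d n eps delta) ^-2 <= T%:R)
  (b : R) (Hb1 : 1 <= b) (Hbn : b <= n%:R) (w0 : 'rV[R]_d)
  (* the algorithm's randomness on a probability space (Om, Q) *)
  (d1 : measure_display) (Om : measurableType d1) (Q : probability Om R)
  (M : nat -> 'I_n -> Om -> bool) (Zeta : nat -> 'I_d -> Om -> R)
  (That : Om -> nat)
  (HMm : forall t i, measurable_fun setT (M t i))
  (HZetam : forall t j, measurable_fun setT (Zeta t j))
  (HThatm : measurable_fun setT That)
  (HMd : forall t i, Q (M t i @^-1` [set true]) = (b / n%:R)%:E)
  (HZetad : forall t j (B : set R), measurable B ->
     Q (Zeta t j @^-1` B) =
     normal_prob 0
       (Num.sqrt (nu * T%:R * ln (delta^-1)
                  * (G * (T%:R^-1 + (dp_phi nu d n eps delta) ^+ 2) `^ (- (2 * k)^-1)) ^+ 2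
                  / (n%:R ^+ 2 * eps ^+ 2))) B)
  (HThatd : forall t : nat, Q (That @^-1` [set t]) =
                         (if (t < T)%N then T%:R^-1 else 0)%:E)
  (HAi : mutually_independent Q (alg_family M Zeta That)) :
  let phi := dp_phi nu d n eps delta in
  let tau := G * (T%:R^-1 + phi ^+ 2) `^ (- (2 * k)^-1) in
  let eta := C / (T%:R * tau) * (T%:R^-1 + phi ^+ 2) `^ (- 2^-1) in
  exists A : set Om0, measurable A /\ ((3 / 4 : R)%:E <= P0 A)%E /\
   forall om0, A om0 ->
   let fi := fun (i : 'I_n) (w : 'rV[R]_d) => loss w (Zs i om0) in
   let f := fun w : 'rV[R]_d => n%:R^-1 * \sum_(i < n) fi i w in
   forall (wstar : 'rV[R]_d) (Dc : R),
     convex_fun f ->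
     (forall w, f wstar <= f w) ->
     0 < Dc ->
     (forall w, Dc < enorm (w - wstar) ->
        16 * phi `^ (1 - k^-1) * G * enorm (w - wstar) < f w - f wstar) ->
     let OR := ('E_Q[fun om => f (dpsgd fi b eta tau M Zeta w0 (That om) om)]
                - (f wstar)%:E)%E in
     (OR <= (G * ((enorm (w0 - wstar) ^+ 2 / C + 2 * C)
                  * (T%:R^-1 + phi ^+ 2) `^ (2^-1 * (1 - k^-1))
                  + 16 * phi `^ (1 - k^-1) * Dc))%:E)%E /\
     (T%:R = phi ^-2 ->
      (OR <= (G * (2 `^ (2^-1 * (1 - k^-1)) * (enorm (w0 - wstar) ^+ 2 / C + 2 * C)
                   + 16 * Dc) * phi `^ (1 - k^-1))%:E)%E).
Proof.
move=> phi tau eta.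
have k0 : 0 < k by exact: lt_trans Hk.
have T0 : 0 < T%:R :> R by rewrite ltr0n.
have n0' : 0 < n%:R :> R by rewrite ltr0n.
have phi_ge0 : 0 <= phi.
  by rewrite /phi /dp_phi divr_ge0 ?sqrtr_ge0// mulr_ge0// ltW.
pose r := T%:R^-1 + phi ^+ 2.
have r0 : 0 < r by rewrite ltr_wpDr ?sqr_ge0// invr_gt0.
pose q := 1 - k^-1.
have tau0 : 0 < tau by rewrite mulr_gt0// powR_gt0.
have rs0 : 0 < r `^ (2^-1) by exact: powR_gt0.
have etaE : eta = C / (T%:R * tau) * (r `^ (2^-1))^-1 by rewrite /eta powRN.
have eta0 : 0 < eta by rewrite etaE mulr_gt0 ?invr_gt0// divr_gt0// mulr_gt0.
have ae_env : {ae D, forall x, forall w, enorm (grad (fun v => loss v x) w) <= Gf x}.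
  exact: HGb.
(* The norm bound is raised to the power [k]; an infinite moment is excluded because its [1/k]-th
   power would be infinite too. *)
have mom : (\int[D]_x (Gf x `^ k)%:E <= (G `^ k)%:E)%E.
  have I0 : (0 <= \int[D]_x (Gf x `^ k)%:E)%E.
    by apply: integral_ge0 => x _; rewrite lee_fin powR_ge0.
  move: Hmom; rewrite unlock.
  case: (\int[D]_x (Gf x `^ k)%:E)%E I0 => [a| |]//.
  - rewrite lee_fin => a0; rewrite poweR_EFin !lee_fin => h.
    have -> : a = (a `^ k^-1) `^ k.
      by rewrite -powRrM mulVf ?gt_eqF// powRr1.
    by apply: ge0_ler_powR; rewrite ?nnegrE ?powR_ge0 ?(ltW k0) ?(ltW HG).
  - by move=> _; rewrite poweRyr ?invr_eq0 ?gt_eqF// leye_eq.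
have [A [mA PA HA]] := empirical_moment_event _ _ _ D n (fun x => Gf x `^ k)
  (G `^ k) _ _ _ P0 Zs Hn (powR_gt0 k HG)
  (measurableT_comp (measurable_powR k) HGfm) (fun x => powR_ge0 _ _) mom
  ae_env HZm HZd.
(* The event is fixed before [wstar] and [Dc] are introduced: it depends on the samples only. *)
exists A; split => //; split => // om0 Aom0 fi f wstar Dc fconv fmin Dc0 fgrow OR.
have [env emp] := HA _ Aom0.
have dfi i w : differentiable (fi i) w by exact: Hdiff.
have cf : continuous f.
  by apply: continuous_mean => i w; exact: differentiable_continuous.
pose beta := 8 * phi `^ q * G.
have beta0 : 0 <= beta by rewrite !mulr_ge0 ?powR_ge0// ltW.
have descent w : f w - f wstar <=
    2 * (n%:R^-1 * \sum_(i < n) dotp (clip (grad (fi i) w) tau) (w - wstar))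
    + 2 * beta * Dc.
  (* For [d = 0] the rate [phi] vanishes, so the bias bound fails and the claim
     is checked directly. *)
  have [dz|dpos] := posnP d.
    have -> : w = wstar.
      by apply/rowP => j; have := ltn_ord j; rewrite {2}dz.
    rewrite !subrr big1 => [|i _]; last by rewrite dotpC dotp0l.
    by rewrite !mulr0 add0r mulr_ge0 ?(ltW Dc0)// mulr_ge0.
  have phi0 : 0 < phi by exact: dp_phi_gt0.
  apply: (@clipped_descent _ _ _ fi wstar w (fun i => Gf (Zs i om0)) tau k beta Dc) => //.
    move=> v Dv; have -> : 2 * beta = 16 * phi `^ q * G by rewrite /beta; ring.
    exact: fgrow.
  rewrite -mulr_suml mulrA.
  apply: (@le_trans _ _ (4 * G `^ k * tau `^ (1 - k))).
    by rewrite ler_wpM2r ?powR_ge0.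
  have -> : 4 * G `^ k * tau `^ (1 - k) = 4 * (tau `^ (1 - k) * G `^ k) by ring.
  rewrite clip_norm_pow// /beta.
  have := privacy_rate_le _ _ _ _ phi0 T0 HT Hk; rewrite -/r -/q => h.
  have -> : 8 * phi `^ q * G = 4 * (G * (2 * phi `^ q)) by ring.
  by rewrite ler_wpM2l// ler_wpM2l// ltW.
pose var := nu * T%:R * ln (delta^-1) * tau ^+ 2 / (n%:R ^+ 2 * eps ^+ 2).
have var0 : 0 < var.
  have ld : 0 < ln (delta^-1) by rewrite ln_gt0// invf_gt1.
  have t2 : 0 < tau ^+ 2 by exact: exprn_gt0.
  rewrite /var; apply: divr_gt0; last by apply: mulr_gt0; exact: exprn_gt0.
  by apply: mulr_gt0 => //; apply: mulr_gt0 => //; exact: mulr_gt0.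
have sd0 : 0 < Num.sqrt var by rewrite sqrtr_gt0.
have ch : continuous (fun v => f v - f wstar).
  by move=> v; apply: continuousB; [exact: cf|exact: cst_continuous].
(* Applied to the gap rather than to [f], since the lemma requires a nonnegative function. *)
have [v [iv vE] vle] := dpsgd_output_mean R _ Om Q d n b eta tau fi w0 M Zeta
  That dfi HMm HZetam HThatm HAi (Num.sqrt var) wstar Hn Hb1 tau0 (ltW eta0) sd0
  HMd HZetad (fun w => f w - f wstar) (2 * beta * Dc) T eta0 HT0 HThatd ch
  (fun w => etrans (subr_ge0 _ _) (fmin w)) (fun t x => descent _).
(* The expectation of [f] is recovered from that of the gap as the finite number [v + f wstar], so
   the extended-real subtraction in [OR] is an ordinary one. *)
have ORE : OR = v%:E.
  have [i' e'] := has_meanD _ _ _ _ _ _ _ _ (conj iv vE)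
    (has_mean_cst _ _ _ Q (f wstar)).
  rewrite /OR unlock.
  have -> : (\int[Q]_om (f (dpsgd fi b eta tau M Zeta w0 (That om) om))%:E =
     (v + f wstar)%:E)%E.
    transitivity (\int[Q]_om ((f (dpsgd fi b eta tau M Zeta w0 (That om) om)
        - f wstar) + f wstar)%:E)%E.
      by apply: eq_integral => om _; rewrite subrK.
    rewrite -[LHS](fineK (integrable_fin_num measurableT i')).
    by congr EFin; exact: e'.
  by rewrite -EFinB addrK.
pose N0 := enorm (w0 - wstar) ^+ 2.
have risk : v <= G * ((N0 / C + 2 * C) * r `^ (2^-1 * q) + 16 * phi `^ q * Dc).
  apply: (le_trans vle).
  have -> : Num.sqrt var ^+ 2 = var by rewrite sqr_sqrtr// ltW.
  rewrite /var dp_noise_variance// -/phi.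
  have r2 : (r `^ 2^-1) ^+ 2 = T%:R^-1 + phi ^+ 2.
    by rewrite powR12_sqrt ?sqr_sqrtr ?(ltW r0).
  have := step_size_balance _ N0 _ _ _ _ _ _ HC T0 tau0 rs0 (sqr_ge0 phi) r2 etaE.
  rewrite /N0 /tau -/r clip_norm_sqrt// -/tau -/q => h.
  apply: (@le_trans _ _ ((N0 / C + 2 * C) * (G * r `^ (2^-1 * q)) + 2 * beta * Dc)).
    by rewrite lerD2r.
  by rewrite le_eqVlt; apply/orP; left; apply/eqP; rewrite /beta /N0; ring.
rewrite ORE !lee_fin; split; first exact: risk.
move=> TE; apply: (le_trans risk).
(* For [T = phi^-2] the sum is exactly [2 phi^2], so the factor [2^((1-1/k)/2)] is kept here without
   rounding. *)
have rE : r = 2 * phi ^+ 2 by rewrite /r TE invrK; ring.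
rewrite rE powRM ?sqr_ge0// -(powR_mulrn 2 phi_ge0) -[(phi `^ _) `^ _]powRrM.
have -> : 2 * (2^-1 * q) = q by field.
rewrite /N0 -/q.
by rewrite le_eqVlt; apply/orP; left; apply/eqP; ring.
Qed.
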